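(* Let $\tilde P_n=\{\mathbf U_1,\dots,\mathbf U_n\}\subseteq[0,1)^s$, $n=b^m$, be a scrambled $(0,m,s)$-net in base $b$ and let $\psi(\mathbf x,\mathbf y)$ be the joint pdf of two distinct points randomly chosen from $\tilde P_n$. Then: (i) The base $b$ Walsh decomposition of $\psi$ takes the form $$\psi(\mathbf x,\mathbf y)=1+\sum_{\mathbf l\in\mathbb N^s,\ \mathbf l\neq\mathbf 0}\hat\psi(\mathbf l)\,\mathrm{wal}_{\mathbf l}(\mathbf x)\overline{\mathrm{wal}_{\mathbf l}(\mathbf y)}.$$ (ii) For $\mathbf 0\neq\mathbf l\in\mathbb N^s$, the value of $\hat\psi(\mathbf l)$ in part (i) is $$\hat\psi(\mathbf l)=-(n-1)^{-1}(1-b)^{1-r}\sum_{i=0}^{r-1-c}(-b)^i\binom{r-1}{i},$$ where $r$ is the number of non-zero coordinates of $\mathbf l$ and $c=\max(|l_1|+\cdots+|l_s|-m,\,0)$ (an empty sum is $0$).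
   Context: $\mathbb N=\{0,1,2,\dots\}$; $b$ is a prime, $s,m\ge1$ are integers, $n=b^m$. Nets. For $\mathbf k\in\mathbb N^s$, a set of $n=b^m$ points in $[0,1)^s$ is $\mathbf k$-equidistributed in base $b$ if every interval $\prod_{j=1}^s[a_jb^{-k_j},(a_j+1)b^{-k_j})$ with $a_j\in\{0,\dots,b^{k_j}-1\}$ contains exactly $b^{m-k_1-\cdots-k_s}$ of the points. It is a $(0,m,s)$-net in base $b$ if it is $\mathbf k$-equidistributed for all $\mathbf k\in\mathbb N^s$ with $k_1+\cdots+k_s\le m$. Common digits. For $x,y\in[0,1)$, $\gamma_b(x,y)$ is the number of initial common base $b$ digits of $x$ and $y$ (using finite expansions whenever possible), i.e. the $i$ with $\lfloor b^ix\rfloor=\lfloor b^iy\rfloor$ and $\lfloor b^{i+1}x\rfloor\ne\lfloor b^{i+1}y\rfloor$ ($\infty$ if $x=y$). For $\mathbf i\in\mathbb N^s$, $D_{\mathbf i}^s=\{(\mathbf x,\mathbf y)\in[0,1)^{2s}:\gamma_b(x_j,y_j)=i_j,\ j=1,\dots,s\}$. Scrambling. A scrambled $(0,m,s)$-net in base $b$ is a random point set $\tilde P_n=\{\mathbf U_1,\dots,\mathbf U_n\}$ obtained from a $(0,m,s)$-net $\{\mathbf V_1,\dots,\mathbf V_n\}$ in base $b$ such that each $\mathbf U_l$ is uniformly distributed on $[0,1)^s$ and, for all $l\neq j$ and $\mathbf i\in\mathbb N^s$, if $(\mathbf V_l,\mathbf V_j)\in D_{\mathbf i}^s$ then $(\mathbf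 U_l,\mathbf U_j)$ is uniformly distributed in $D_{\mathbf i}^s$. The joint pdf $\psi$ is the density (with respect to Lebesgue measure on $[0,1)^{2s}$, defined up to null sets) of $(\mathbf U_I,\mathbf U_J)$, where $(I,J)$ is a uniformly random ordered pair of distinct indices, independent of the scrambling. Walsh functions. For $l\in\mathbb N$ with $l=\lambda_0+\lambda_1b+\lambda_2b^2+\cdots$ and $x\in[0,1)$ with $x=\xi_1b^{-1}+\xi_2b^{-2}+\cdots$ (finite expansion if possible), $\mathrm{wal}_l(x)=\omega_b^{\lambda_0\xi_1+\lambda_1\xi_2+\cdots}$ with $\omega_b=e^{2\pi i/b}$; for vectors, $\mathrm{wal}_{\mathbf l}(\mathbf x)=\prod_{j=1}^s\mathrm{wal}_{l_j}(x_j)$. For $l\in\mathbb N$, $|l|$ is the number of base $b$ digits of $l$, i.e. $|0|=0$ and $|l|=k$ when $b^{k-1}\le l<b^k$. *)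

(* Defs.v *)
From HB Require Import structures.
From mathcomp Require Import all_boot all_order all_algebra.
From mathcomp Require Import finmap.
From mathcomp Require Import all_classical all_reals all_analysis.
From mathcomp Require Import complex.
From mathcomp Require summability.

Set Implicit Arguments.
Unset Strict Implicit.
Unset Printing Implicit Defensive.
Import Order.TTheory GRing.Theory Num.Theory.
Import numFieldNormedType.Exports.

Local Open Scope classical_set_scope.
Local Open Scope ring_scope.

Notation Rvec R s := (s.-tuple (measurableTypeR R)).

(* Lebesgue measure on R^s, by induction on s: the point mass on R^0, then the
   image of the product measure under R x R^s ~ R^(s+1). *)
Section lebesgue_tuple.
Context (R : realType).

Definition tuple_consp (s : nat) (p : measurableTypeR R * Rvec R s) :
  Rvec R s.+1 := [the s.+1.-tuple _ of p.1 :: p.2].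

Definition tuple_unconsp (s : nat) (t : Rvec R s.+1) :
  measurableTypeR R * Rvec R s := (thead t, [tuple of behead t]).

Lemma tuple_conspK s : cancel (@tuple_consp s) (@tuple_unconsp s).
Proof. by case=> x t; congr pair; apply/val_inj. Qed.

Lemma tuple_unconspK s : cancel (@tuple_unconsp s) (@tuple_consp s).
Proof. by move=> t; rewrite [t in RHS]tuple_eta; apply/val_inj. Qed.

Lemma measurable_tuple_consp s : measurable_fun setT (@tuple_consp s).
Proof. exact: measurable_cons. Qed.

Lemma measurable_tuple_unconsp s : measurable_fun setT (@tuple_unconsp s).
Proof.
apply/measurable_fun_pairP; split.
  rewrite (_ : _ \o _ = fun t => tnth t ord0); last exact/funext.
  exact: measurable_tnth.
exact: measurable_behead.
Qed.

Section lebesgue_cons.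
Context (s : nat) (mu : {sigma_finite_measure set (Rvec R s) -> \bar R}).

HB.instance Definition _ := isMeasurableFun.Build _ _ _ _
  (@tuple_consp s) (@measurable_tuple_consp s).

Definition lebesgue_cons : set (Rvec R s.+1) -> \bar R :=
  pushforward (@lebesgue_measure R \x mu)%E (@tuple_consp s).

Let lebesgue_cons0 : lebesgue_cons set0 = 0%E.
Proof. exact: measure0. Qed.

Let lebesgue_cons_ge0 A : (0 <= lebesgue_cons A)%E.
Proof. exact: measure_ge0. Qed.

Let lebesgue_cons_sigma_additive : semi_sigma_additive lebesgue_cons.
Proof. exact: measure_semi_sigma_additive. Qed.

HB.instance Definition _ := isMeasure.Build _ _ _ lebesgue_cons
  lebesgue_cons0 lebesgue_cons_ge0 lebesgue_cons_sigma_additive.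

Lemma lebesgue_cons_sigma_finite : sigma_finite setT lebesgue_cons.
Proof.
have /sigma_finiteP[F [TF ndF Foo]] := sigma_finiteT (@lebesgue_measure R).
have /sigma_finiteP[G [TG ndG Goo]] := sigma_finiteT mu.
exists (fun n => @tuple_unconsp s @^-1` (F n `*` G n)).
  rewrite -preimage_bigcup (_ : \bigcup_n _ = setT) ?preimage_setT//.
  rewrite -subTset => -[x y] _.
  have [k _ Fkx] : (\bigcup_n F n) x by rewrite -TF.
  have [l _ Gly] : (\bigcup_n G n) y by rewrite -TG.
  exists (maxn k l) => //; split => /=.
  - by move: x Fkx; exact/subsetPset/ndF/leq_maxl.
  - by move: y Gly; exact/subsetPset/ndG/leq_maxr.
move=> n; have [mF Fn] := Foo n; have [mG Gn] := Goo n; split.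
  rewrite -[X in measurable X]setTI; apply: measurable_tuple_unconsp => //.
  exact: measurableX.
rewrite /lebesgue_cons /pushforward -comp_preimage.
rewrite (_ : _ \o _ = id); last by apply/funext => p /=; rewrite tuple_conspK.
by rewrite preimage_id product_measure1E// lte_mul_pinfty// ge0_fin_numE.
Qed.

HB.instance Definition _ := Measure_isSigmaFinite.Build _ _ _
  lebesgue_cons lebesgue_cons_sigma_finite.

End lebesgue_cons.

Fixpoint lebesgue_tuple (s : nat) :
    {sigma_finite_measure set (Rvec R s) -> \bar R} :=
  if s is s'.+1 then lebesgue_cons (lebesgue_tuple s')
  else \d_([tuple] : Rvec R 0).

Lemma measurable_tuple_box s (A : 'I_s -> set (measurableTypeR R)) :
  (forall j, measurable (A j)) ->
  measurable [set x : Rvec R s | forall j, A j (tnth x j)].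
Proof.
move=> mA.
rewrite (_ : mkset _ =
    \bigcap_(j in [set: 'I_s]) ((fun x : Rvec R s => tnth x j) @^-1` A j)).
  apply: fin_bigcap_measurable => // j _.
  by rewrite -[X in measurable X]setTI; exact: measurable_tnth.
by apply/seteqP; split => x /= xA j => [_|]; exact: xA.
Qed.

Lemma lebesgue_tuple_box s (A : 'I_s -> set (measurableTypeR R)) :
  (forall j, measurable (A j)) ->
  lebesgue_tuple s [set x | forall j, A j (tnth x j)] =
  (\big[mule/1]_(j < s) lebesgue_measure (A j))%E.
Proof.
elim: s => [|s IH] in A * => mA.
  by rewrite big_ord0/= diracE mem_set//= => -[].
rewrite big_ord_recl -IH//.
rewrite -[LHS]/((@lebesgue_measure R \x lebesgue_tuple s)%E
  (@tuple_consp s @^-1` [set x | forall j, A j (tnth x j)])).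
rewrite -product_measure1E; [|exact: mA|exact: (measurable_tuple_box (fun j => mA _))].
congr (_ _); apply/seteqP; split => -[x t] /=.
  move=> At; split=> [|j]; first exact: (At ord0).
  by have := At (lift ord0 j); rewrite tnthS.
move=> [Ax At] j; case: (unliftP ord0 j) => [k|] -> //.
by rewrite tnthS; exact: At.
Qed.

End lebesgue_tuple.

Section digits.
Context (R : realType) (b : nat).

(* |l|: the number of base b digits of l, i.e. the least k with l < b ^ k (for
   b > 1). *)
Definition ndigits (l : nat) : nat := up_log b l.+1.

Lemma ndigits0 : ndigits 0 = 0%N.
Proof. exact: up_log1. Qed.

Lemma ndigits_bounds (l : nat) : (1 < b)%N -> (0 < l)%N ->
  (b ^ (ndigits l).-1 <= l < b ^ ndigits l)%N.
Proof. by move=> b1 l0; rewrite -ltnS; exact: up_log_bounds. Qed.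

(* lambda_i in l = lambda_0 + lambda_1 b + lambda_2 b^2 + ... *)
Definition nat_digit (l i : nat) : nat := (l %/ b ^ i %% b)%N.

(* xi_i (i >= 1) in x = xi_1 / b + xi_2 / b^2 + ..., for 0 <= x < 1; taking
   floors selects the finite expansion whenever there is one. *)
Definition real_digit (x : R) (i : nat) : nat :=
  (Num.truncn (b%:R ^+ i * x) %% b)%N.

(* gamma_b(x, y) = i, as a relation. For x, y in [0, 1) at most one i qualifies,
   and none does when x = y, where gamma_b is infinite. *)
Definition common_digits (x y : R) (i : nat) : Prop :=
  Num.floor (b%:R ^+ i * x) = Num.floor (b%:R ^+ i * y) /\
  Num.floor (b%:R ^+ i.+1 * x) <> Num.floor (b%:R ^+ i.+1 * y).

End digits.

Section nets.
Context (R : realType) (b s : nat).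

Definition cube : set (Rvec R s) :=
  [set x | forall j, 0 <= tnth x j < 1].

Definition cube2 : set (Rvec R s * Rvec R s) := cube `*` cube.

Definition in_elementary (k a : s.-tuple nat) (x : Rvec R s) : bool :=
  [forall j, ((tnth a j)%:R / b%:R ^+ tnth k j <= tnth x j)
          && (tnth x j < (tnth a j).+1%:R / b%:R ^+ tnth k j)].

(* Point sets are given by an enumeration V of their b ^ m points. The exponent
   m - k_1 - ... - k_s is an integer, possibly negative. *)
Definition equidistributed (m : nat) (k : s.-tuple nat)
    (V : 'I_(b ^ m) -> Rvec R s) : Prop :=
  forall a : s.-tuple nat, (forall j, tnth a j < b ^ tnth k j)%N ->
    #|[pred l | in_elementary k a (V l)]|%:R =
    b%:R ^ (m%:Z - (\sum_(j < s) tnth k j)%N%:Z) :> R.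

Definition is_net (m : nat) (V : 'I_(b ^ m) -> Rvec R s) : Prop :=
  (forall l, cube (V l)) /\
  forall k : s.-tuple nat,
    (\sum_(j < s) tnth k j <= m)%N -> equidistributed k V.

Definition Dset (i : s.-tuple nat) : set (Rvec R s * Rvec R s) :=
  cube2 `&`
  [set z | forall j,
     common_digits b (tnth z.1 j) (tnth z.2 j) (tnth i j)].

End nets.
Arguments cube {R s}.
Arguments cube2 {R s}.
Arguments Dset {R} b {s} i.

(* Lebesgue measure on R^s x R^s. *)
Notation lebesgue2 R s := (lebesgue_tuple R s \x lebesgue_tuple R s)%E.

Section scrambling.
Context (R : realType) (b s m : nat).
Context (d : measure_display) (Omega : measurableType d).
Context (P : probability Omega R).

Definition uniform_on (d' : measure_display) (T : measurableType d')
    (mu : set T -> \bar R) (D : set T) (X : Omega -> T) : Prop :=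
  measurable_fun setT X /\
  forall A, measurable A -> P (X @^-1` A) = (mu (A `&` D) / mu D)%E.

Definition is_scrambling (V : 'I_(b ^ m) -> Rvec R s)
    (U : 'I_(b ^ m) -> Omega -> Rvec R s) : Prop :=
  [/\ forall l w, cube (U l w),
      forall l, uniform_on (lebesgue_tuple R s) cube (U l)
    & forall l j (i : s.-tuple nat), l != j -> Dset b i (V l, V j) ->
        uniform_on (lebesgue2 R s) (Dset b i) (fun w => (U l w, U j w))].

(* (I, J) is a uniformly random ordered pair of distinct indices, independent
   of the family U (whose generated sigma-algebra is g_sigma_preimage U). *)
Definition is_random_pair (n : nat) (U : 'I_n -> Omega -> Rvec R s)
    (I J : Omega -> 'I_n) : Prop :=
  forall l j,
  let E := [set w | I w = l /\ J w = j] in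
  [/\ measurable E,
      P E = (if l == j then 0 else (n%:R * (n%:R - 1))^-1)%:E
    & forall B, g_sigma_preimage U B -> P (E `&` B) = (P E * P B)%E].

Definition is_joint_pdf (n : nat) (U : 'I_n -> Omega -> Rvec R s)
    (I J : Omega -> 'I_n) (psi : Rvec R s * Rvec R s -> R) : Prop :=
  [/\ measurable_fun cube2 psi,
      forall z, cube2 z -> 0 <= psi z
    & forall A, measurable A ->
        P [set w | A (U (I w) w, U (J w) w)] =
        (\int[lebesgue2 R s]_(z in A `&` cube2) (psi z)%:E)%E].

End scrambling.

Section walsh.
Context (R : realType) (b s : nat).

Definition omega : R[i] :=
  Complex (cos (2 * pi / b%:R)) (sin (2 * pi / b%:R)).

Definition wal1 (l : nat) (x : R) : R[i] :=
  omega ^+ (\sum_(i < ndigits b l) nat_digit b l i * real_digit b x i.+1)%N.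

Definition wal (l : s.-tuple nat) (x : Rvec R s) : R[i] :=
  \prod_(j < s) wal1 (tnth l j) (tnth x j).

(* Coefficient of psi(x, y) on wal_k(x) conj(wal_l(y)). When k and l range over
   N^s these products are, up to reindexing l, the Walsh functions on
   [0, 1)^(2s). *)
Definition walsh_coef (psi : Rvec R s * Rvec R s -> R)
    (k l : s.-tuple nat) : R[i] :=
  let f z := (psi z)%:C%C * conjc (wal k z.1 * conjc (wal l z.2)) in
  Complex (\int[lebesgue2 R s]_(z in cube2) complex.Re (f z))
          (\int[lebesgue2 R s]_(z in cube2) complex.Im (f z)).

Definition mzero_idx : s.-tuple nat := [tuple 0%N | _ < s].

(* The Walsh series of psi is diagonal, with constant term 1, and converges to
   psi almost everywhere on [0, 1)^(2s); the convergence is unordered, i.e.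
   along the finite sets of indices directed by inclusion. *)
Definition diagonal_walsh_decomposition
    (psi : Rvec R s * Rvec R s -> R) : Prop :=
  [/\ walsh_coef psi mzero_idx mzero_idx = 1,
      forall k l, k != l -> walsh_coef psi k l = 0
    & {ae lebesgue2 R s, forall z, cube2 z ->
        (fun F : {fset s.-tuple nat} =>
           1 + \sum_(l <- F | l != mzero_idx)
                 walsh_coef psi l l * wal l z.1 * conjc (wal l z.2) : R[i]^o)
          @ summability.totally --> ((psi z)%:C%C : R[i]^o)}].

Definition nonzero_coords (l : s.-tuple nat) : nat :=
  #|[pred j | tnth l j != 0%N]|.

(* max(|l_1| + ... + |l_s| - m, 0): the subtraction on nat is truncated. *)
Definition excess (m : nat) (l : s.-tuple nat) : nat :=
  ((\sum_(j < s) ndigits b (tnth l j)) - m)%N.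

End walsh.
Arguments mzero_idx {s}.
Arguments diagonal_walsh_decomposition {R} b {s} psi.

(* Main.v *)
(* Up to null sets, psi is the mixture over ordered pairs l != j of the uniform
   densities on the sets D_i with (V_l, V_j) in D_i. The normalized indicator of
   {gamma = i} in one coordinate is a combination of the two Walsh kernels
   sum_(l < b^k) wal_l(x) conj(wal_l(y)) = b^k [gamma(x, y) >= k], k = i, i + 1;
   multiplying over coordinates shows that psi is a diagonal Walsh polynomial,
   and orthogonality of the Walsh functions on a fine grid identifies its Walsh
   coefficients. Each of them is then an alternating sum, over the subsets A of
   the support of l, of the number of pairs of net points sharing a box of
   resolution (|l_j| - [j in A])_j; equidistribution makes this number depend on
   #|A| only, which leaves a sum of binomial coefficients. *)
Require Import Defs.
From HB Require Import structures.
From mathcomp Require Import all_boot all_order all_algebra.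
From mathcomp Require Import finmap.
From mathcomp Require Import all_classical all_reals all_analysis.
From mathcomp Require Import complex.
From mathcomp Require Import measurable_realfun.
From mathcomp Require summability.
From mathcomp Require Import ring lra zify.
Import Order.TTheory GRing.Theory Num.Theory.
Import numFieldNormedType.Exports.
Local Open Scope classical_set_scope.
Local Open Scope ring_scope.

Set Implicit Arguments.
Unset Strict Implicit.

(** * Base b digits *)

Section base_expansion.
Variables (R : realType) (b : nat).
Hypothesis b_gt1 : (1 < b)%N.
Implicit Types (x y : R) (i k K M q : nat).

(** The integer whose base b digits are the first [k] digits of [x], for [x] in [0, 1). Truncating
    to nat keeps all digit arithmetic in nat. *)
Definition level (k : nat) (x : R) : nat := Num.truncn (b%:R ^+ k * x).

(** On [0, 1) this is the condition gamma_b(x, y) >= k. *)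
Definition agree (k : nat) (x y : R) : bool := level k x == level k y.

Let b_gt0 : (0 < b)%N := ltnW b_gt1.

(** Nested floors collapse; levels can then be compared by integer division alone. *)
Lemma truncn_mull (c : nat) (y : R) : (0 < c)%N -> 0 <= y ->
  Num.truncn y = (Num.truncn (c%:R * y) %/ c)%N.
Proof.
move=> c0 y0; apply/truncn_def.
have cR : 0 < c%:R :> R by rewrite ltr0n.
have /truncn_itv/andP[h1 h2] : 0 <= c%:R * y by rewrite mulr_ge0.
set t := Num.truncn _ in h1 h2 *.
apply/andP; split.
  rewrite -(ler_pM2l cR); apply: le_trans h1.
  by rewrite -natrM ler_nat mulnC leq_divM.
rewrite -(ltr_pM2l cR); apply: lt_le_trans h2 _.
by rewrite -natrM ler_nat mulnC ltn_ceil.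
Qed.

Lemma levelD k j x : 0 <= x -> level k x = (level (k + j) x %/ b ^ j)%N.
Proof.
move=> x0; rewrite /level (@truncn_mull (b ^ j)) ?expn_gt0 ?b_gt0 ?mulr_ge0//.
by rewrite natrX mulrA -exprD addnC.
Qed.

Lemma level_leq k K x : 0 <= x -> (k <= K)%N ->
  level k x = (level K x %/ b ^ (K - k))%N.
Proof. by move=> x0 kK; rewrite (@levelD k (K - k))// subnKC. Qed.

Lemma levelS k x : 0 <= x ->
  level k.+1 x = (level k x * b + real_digit b x k.+1)%N.
Proof. by move=> x0; rewrite (@levelD k 1)// addn1 expn1 -divn_eq. Qed.

Lemma level_lt k x : 0 <= x < 1 -> (level k x < b ^ k)%N.
Proof.
move=> /andP[x0 x1]; rewrite -(ltr_nat R) natrX.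
have /truncn_itv/andP[h _] : 0 <= b%:R ^+ k * x by rewrite mulr_ge0.
by apply: le_lt_trans h _; rewrite gtr_pMr// exprn_gt0// ltr0n.
Qed.

Lemma level0 x : 0 <= x < 1 -> level 0 x = 0%N.
Proof. by move=> /(level_lt 0); case: level. Qed.

Lemma agree_leq k K x y : 0 <= x -> 0 <= y -> (k <= K)%N ->
  agree K x y -> agree k x y.
Proof. by rewrite /agree => x0 y0 kK /eqP e; rewrite !(@level_leq k K)// e. Qed.

Lemma agreeS k x y : 0 <= x -> 0 <= y -> agree k.+1 x y =
  agree k x y && (real_digit b x k.+1 == real_digit b y k.+1).
Proof.
move=> x0 y0; apply/idP/andP => [a|[/eqP e1 /eqP e2]].
  split; first exact: agree_leq a.
  by move/eqP: a; rewrite /level /real_digit => ->.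
by rewrite /agree !levelS// e1 e2.
Qed.

Lemma floor_level k x : 0 <= x -> Num.floor (b%:R ^+ k * x) = (level k x)%:Z.
Proof.
move=> x0; apply/floor_def.
have /truncn_itv/andP[h1 h2] : 0 <= b%:R ^+ k * x by rewrite mulr_ge0.
by rewrite -[(level k x)%:Z + 1]/(Posz (level k x + 1)) addn1 -!pmulrn h1 h2.
Qed.

Lemma common_digitsE x y i : 0 <= x -> 0 <= y ->
  common_digits b x y i <-> agree i x y && ~~ agree i.+1 x y.
Proof.
move=> x0 y0; rewrite /common_digits !floor_level// /agree; split.
  by move=> [[->]] h; rewrite eqxx/=; apply/eqP => e; apply: h; rewrite e.
by move=> /andP[/eqP -> /eqP h]; split=> // -[].
Qed.

Lemma agree_common i k x y : 0 <= x -> 0 <= y -> common_digits b x y i ->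
  agree k x y = (k <= i)%N.
Proof.
move=> x0 y0 /(@common_digitsE _ _ _ x0 y0) /andP[h1 h2]; case: leqP => h.
  exact: agree_leq h h1.
by apply: contraNF h2; exact: agree_leq.
Qed.

(** Left endpoint of the [q]-th b-adic interval of length b^-M. It represents that interval, on
    which Walsh functions of index below b^M are constant. *)
Definition grid (M q : nat) : R := q%:R / b%:R ^+ M.

Lemma grid_itv M q : (q < b ^ M)%N -> 0 <= grid M q < 1.
Proof.
move=> qM; rewrite /grid divr_ge0//= ltr_pdivrMr ?exprn_gt0 ?ltr0n//.
by rewrite mul1r -natrX ltr_nat.
Qed.

Lemma level_grid M q : level M (grid M q) = q.
Proof.
by rewrite /level /grid mulrCA divff ?mulr1 ?natrK// expf_neq0// pnatr_eq0 -lt0n.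
Qed.

Lemma level_itv M q x : 0 <= x -> (level M x == q) =
  (q%:R / b%:R ^+ M <= x < q.+1%:R / b%:R ^+ M).
Proof.
move=> x0; have bM : 0 < b%:R ^+ M :> R by rewrite exprn_gt0// ltr0n.
rewrite /level truncn_eq ?mulr_ge0//.
by rewrite ler_pdivrMr// ltr_pdivlMr// ![_ * x]mulrC.
Qed.

End base_expansion.

(** * Walsh functions *)

Section walsh_theory.
Variables (R : realType) (b : nat).
Hypothesis b_gt1 : (1 < b)%N.
Implicit Types (x y : R) (i k K M q l : nat).

Let b_gt0 : (0 < b)%N := ltnW b_gt1.

Local Notation omega := (omega R b).

Lemma omegaX n : omega ^+ n =
  Complex (cos (2 * pi / b%:R * n%:R)) (sin (2 * pi / b%:R * n%:R)) :> R[i].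
Proof.
rewrite /Defs.omega; move: (_ / _) => t.
elim: n => [|n IH]; first by rewrite mulr0 cos0 sin0.
rewrite exprS IH (_ : n.+1%:R = 1 + n%:R :> R); last by rewrite nat1r.
rewrite mulrDr mulr1 cosD sinD.
by apply/eqP; rewrite eq_complex /= eqxx addrC eqxx.
Qed.

Lemma omegaXb : omega ^+ b = 1 :> R[i].
Proof.
rewrite omegaX divfK ?pnatr_eq0 -?lt0n// mulr_natl cos2pi.
by rewrite mulr2n sinD sinpi mul0r mulr0 addr0.
Qed.

(** With t half the angle, 0 < t < pi, so the real part 1 - 2 sin(t)^2 is below 1. *)
Lemma omegaX_neq1 n : (0 < n < b)%N -> omega ^+ n != 1 :> R[i].
Proof.
move=> /andP[n0 nb]; rewrite omegaX eq_complex /= negb_and; apply/orP; left.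
set t : R := pi * (n%:R / b%:R).
have -> : 2 * pi / b%:R * n%:R = t *+ 2 by rewrite -mulr_natl /t; ring.
have t0 : 0 < sin t.
  rewrite sin_gt0_pi// /t mulr_gt0 ?pi_gt0 ?divr_gt0 ?ltr0n//=.
  by rewrite gtr_pMr ?pi_gt0// ltr_pdivrMr ?ltr0n// mul1r ltr_nat.
rewrite cos_mulr2n cos2sin2; apply/eqP => h.
have : 0 < sin t ^+ 2 by rewrite exprn_gt0.
by move: h; lra.
Qed.

Lemma omega_conj : omega * conjc omega = 1 :> R[i].
Proof.
rewrite /Defs.omega; apply/eqP; rewrite eq_complex /=; apply/andP; split; apply/eqP.
  by rewrite mulrN opprK -!expr2 cos2Dsin2.
by ring.
Qed.

Lemma omegaX_conj n : omega ^+ n * conjc (omega ^+ n) = 1 :> R[i].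
Proof. by rewrite rmorphXn/= -exprMn omega_conj expr1n. Qed.

(** Orthogonality of the characters of Z/b: for p <> q the ratio z = omega^(p - q) is a b-th root of
    unity other than 1, so its geometric sum vanishes. *)
Lemma sum_omega p q : (p < b)%N -> (q < b)%N ->
  \sum_(a < b) omega ^+ (a * p) * conjc (omega ^+ (a * q)) =
  (if p == q then b%:R else 0) :> R[i].
Proof.
move=> pb qb; case: eqP => [->|/eqP pq].
  by rewrite (eq_bigr _ (fun a _ => omegaX_conj _)) sumr_const card_ord.
set z : R[i] := omega ^+ p * conjc (omega ^+ q).
rewrite (eq_bigr (fun a : 'I_b => z ^+ a)); last first.
  by move=> a _; rewrite exprMn -rmorphXn/= -!exprM !(mulnC a).
have zb : z ^+ b = 1.
  rewrite exprMn -rmorphXn/= -!exprM ![(_ * b)%N]mulnC !exprM omegaXb.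
  by rewrite !expr1n conjc1 mulr1.
have z1 : z - 1 != 0.
  rewrite subr_eq0; apply/eqP => zE.
  (* Conjugating [zE] exchanges p and q, so p < q may be assumed; then [zE] forces omega^(q - p) = 1
     with 0 < q - p < b. *)
  wlog pq' : p q pb qb pq @z zb zE / (p < q)%N.
    move=> H; have [h|h|h] := ltngtP p q; last by rewrite h eqxx in pq.
      exact: (H p q).
    have zE' : omega ^+ q * conjc (omega ^+ p) = 1 :> R[i].
      by rewrite -[RHS]conjc1 -zE rmorphM/= conjcK mulrC.
    by apply: (H q p) => //; rewrite ?zE' ?expr1n// eq_sym.
  have pE : omega ^+ p = omega ^+ q :> R[i].
    by rewrite -[RHS]mul1r -zE /z -mulrA [_ * omega ^+ q]mulrC omegaX_conj mulr1.
  have := @omegaX_neq1 (q - p); rewrite subn_gt0 pq'/=.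
  move=> /(_ (leq_ltn_trans (leq_subr _ _) qb)).
  rewrite -[X in X != _]mulr1 -(omegaX_conj p) mulrA -exprD subnK 1?ltnW//.
  by rewrite -pE omegaX_conj eqxx.
by apply: (mulfI z1); rewrite -subrX1 zb subrr mulr0.
Qed.

Lemma nat_digit_small l i : (l < b ^ i)%N -> nat_digit b l i = 0%N.
Proof. by move=> h; rewrite /nat_digit divn_small// mod0n. Qed.

Lemma ndigits_leq l k : (ndigits b l <= k)%N = (l < b ^ k)%N.
Proof.
apply/idP/idP => [h|]; last exact: up_log_min.
by apply: leq_trans (up_logP l.+1 b_gt1) _; rewrite leq_exp2l.
Qed.

Lemma wal1_digits k l x : (l < b ^ k)%N -> wal1 b l x =
  omega ^+ (\sum_(i < k) nat_digit b l i * real_digit b x i.+1)%N.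
Proof.
move=> lk; rewrite /wal1; congr (_ ^+ _).
have nk : (ndigits b l <= k)%N by rewrite ndigits_leq.
rewrite -(big_mkord xpredT (fun i => nat_digit b l i * real_digit b x i.+1)%N).
rewrite -(big_mkord xpredT (fun i => nat_digit b l i * real_digit b x i.+1)%N).
rewrite [RHS](big_cat_nat (leq0n _) nk)/= [X in (_ + X)%N]big_nat_cond.
rewrite [X in (_ + X)%N]big1 ?addn0// => i.
by rewrite andbT => /andP[h _]; rewrite nat_digit_small// -ndigits_leq.
Qed.

(** Adding a b^k only sets digit k of the index to a, which contributes one more root of unity. *)
Lemma wal1_block k l a x : (l < b ^ k)%N -> (a < b)%N ->
  wal1 b (a * b ^ k + l) x = wal1 b l x * omega ^+ (a * real_digit b x k.+1).
Proof.
move=> lk ab; rewrite (@wal1_digits k.+1); last first.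
  rewrite expnS -addSn -subn_gt0 subnDA subn_gt0.
  have : (a.+1 * b ^ k <= b * b ^ k)%N by rewrite leq_mul2r ab orbT.
  by rewrite mulSn; lia.
rewrite big_ord_recr exprD/=; congr (_ * _ ^+ (_ * _)).
  rewrite (wal1_digits _ lk); congr (_ ^+ _); apply: eq_bigr => i _.
  congr (_ * _)%N; rewrite /nat_digit.
  have -> : (b ^ k = b ^ (k - i.+1) * b * b ^ i)%N.
    by rewrite -mulnA -expnS -expnD subnK.
  by rewrite !mulnA divnMDl ?expn_gt0 ?b_gt0// modnMDl.
by rewrite /nat_digit divnMDl ?expn_gt0 ?b_gt0// divn_small// addn0 modn_small.
Qed.

Lemma wal1_0 x : wal1 b 0 x = 1.
Proof. by rewrite (@wal1_digits 0)// big_ord0. Qed.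

Lemma sum_nat_block (V : nmodType) (N c : nat) (F : nat -> V) :
  \sum_(0 <= l < c * N) F l = \sum_(a < c) \sum_(0 <= l < N) F (a * N + l)%N.
Proof.
elim: c => [|c IH]; first by rewrite mul0n big_nil big_ord0.
rewrite big_ord_recr/= -IH mulSn addnC (@big_cat_nat _ _ _ (c * N))%N ?leq_addr//=.
congr (_ + _); rewrite -{1}[(c * N)%N]add0n big_addn addKn.
by apply: eq_bigr => i _; rewrite addnC.
Qed.

(** Induction on k. Splitting the index as a b^k + l factors the sum, and by [sum_omega] the sum
    over a tests equality of the digits number k + 1. *)
Lemma walsh_kernel k x y : 0 <= x < 1 -> 0 <= y < 1 ->
  \sum_(0 <= l < b ^ k) wal1 b l x * conjc (wal1 b l y) =
  (if agree b k x y then b%:R ^+ k else 0).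
Proof.
move=> x01 y01; have [[x0 _] [y0 _]] := (andP x01, andP y01).
elim: k => [|k IH].
  by rewrite big_nat1 !wal1_0 conjc1 mulr1 /agree !level0.
rewrite expnS sum_nat_block agreeS//.
transitivity ((\sum_(a < b) omega ^+ (a * real_digit b x k.+1) *
    conjc (omega ^+ (a * real_digit b y k.+1))) *
  \sum_(0 <= l < b ^ k) wal1 b l x * conjc (wal1 b l y)).
  rewrite mulr_suml; apply: eq_bigr => a _; rewrite mulr_sumr.
  apply: eq_big_nat => l /= lk; rewrite !wal1_block// rmorphM/=; ring.
rewrite sum_omega ?ltn_pmod// IH; case: agree; case: eqP => _ /=;
  by rewrite ?mulr0 ?mul0r// exprS.
Qed.

(* Coefficient of wal_l(x) conj(wal_l(y)) in the uniform density on the set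
   {(x, y) | gamma(x, y) = i}; it equals 1, -1 / (b - 1) or 0 according as
   |l| <= i, |l| = i + 1 or |l| > i + 1. *)
Definition kfactor (l i : nat) : R :=
  (b%:R * (l < b ^ i)%:R - (l < b ^ i.+1)%:R) / (b%:R - 1).

(** The kernels for k = i and k = i + 1, weighted by b and 1, both have height b^(i+1): they cancel
    when i + 1 digits agree, and only the first remains when exactly i do. The bound [i < M] keeps
    both within the range of summation. *)
Lemma sum_walsh_kfactor M i x y : 0 <= x < 1 -> 0 <= y < 1 -> (i < M)%N ->
  \sum_(l < b ^ M) (kfactor l i)%:C%C * (wal1 b l x * conjc (wal1 b l y)) =
  (if agree b i x y && ~~ agree b i.+1 x y
   then b%:R ^+ i.+1 / (b%:R - 1) else 0).
Proof.
move=> x01 y01 iM.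
pose F l := wal1 b l x * conjc (wal1 b l y).
have sumF k : (k <= M)%N -> \sum_(l < b ^ M) (l < b ^ k)%:R * F l =
    (if agree b k x y then b%:R ^+ k else 0).
  move=> kM; rewrite -walsh_kernel//.
  rewrite (@big_nat_widen _ _ _ _ _ (b ^ M)) ?leq_exp2l//.
  rewrite big_mkord [RHS]big_mkcond/=.
  by apply: eq_bigr => l _; case: ifP; rewrite ?mul1r ?mul0r.
rewrite (eq_bigr (fun l : 'I_(b ^ M) =>
   ((b%:R - 1)^-1 * b%:R) * ((l < b ^ i)%N%:R * F l)
   - (b%:R - 1)^-1 * ((l < b ^ i.+1)%N%:R * F l))); last first.
  move=> l _; rewrite /kfactor rmorphM/= fmorphV/= !rmorphB/= rmorphM/=.
  by rewrite !rmorph_nat rmorph1 -/(F l); ring.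
rewrite big_split/= sumrN -!mulr_sumr !sumF// 1?ltnW//.
have [[x0 _] [y0 _]] := (andP x01, andP y01).
have h : agree b i.+1 x y -> agree b i x y by apply: agree_leq.
case: (agree b i.+1 x y) h => [->//|_]; first by rewrite /= exprS; ring.
by case: agree => /=; rewrite ?exprS; ring.
Qed.

End walsh_theory.

(** * Walsh functions in several variables *)

Section multivariate.
Variables (R : realType) (b s : nat).
Hypothesis b_gt1 : (1 < b)%N.
Implicit Types (x y : R) (i k M l : nat).

Let b_gt0 : (0 < b)%N := ltnW b_gt1.

Lemma wal1_level M l x y : (l < b ^ M)%N -> 0 <= x -> 0 <= y ->
  level b M x = level b M y -> wal1 b l x = wal1 b l y.
Proof.
move=> lM x0 y0 e; rewrite !(wal1_digits b_gt1 _ lM); congr (_ ^+ _).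
apply: eq_bigr => i _; congr (_ * _)%N.
rewrite -[LHS]/(level b i.+1 x %% b)%N -[RHS]/(level b i.+1 y %% b)%N.
by rewrite (level_leq b_gt1 x0 (ltn_ord i)) (level_leq b_gt1 y0 (ltn_ord i)) e.
Qed.

(* The Walsh matrix is square, and walsh_kernel says that its columns are
   orthogonal; hence so are its rows. *)
Lemma wal1_orthogonal M k l : (k < b ^ M)%N -> (l < b ^ M)%N ->
  \sum_(q < b ^ M) wal1 b k (grid R b M q) * conjc (wal1 b l (grid R b M q)) =
  (if k == l then b%:R ^+ M else 0).
Proof.
move=> kM lM; have bM : b%:R ^+ M != 0 :> R[i].
  by rewrite expf_neq0// pnatr_eq0 -lt0n.
pose A : 'M[R[i]]_(b ^ M) := \matrix_(i, j) wal1 b i (grid R b M j).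
pose B : 'M[R[i]]_(b ^ M) :=
  \matrix_(i, j) ((b%:R ^+ M)^-1 * conjc (wal1 b j (grid R b M i))).
have BA : B *m A = 1%:M.
  apply/matrixP => p q; rewrite !mxE.
  transitivity ((b%:R ^+ M)^-1 * conjc (\sum_(0 <= l < b ^ M)
      wal1 b l (grid R b M p) * conjc (wal1 b l (grid R b M q)))).
    rewrite big_mkord rmorph_sum mulr_sumr; apply: eq_bigr => j _.
    by rewrite !mxE rmorphM/= conjcK mulrA.
  rewrite walsh_kernel ?grid_itv// /agree !level_grid//.
  by rewrite -[RHS]/((p == q :> nat)%:R); case: eqP => _;
    rewrite ?conjc0 ?mulr0// rmorphXn/= conjc_nat mulVf.
have /matrixP/(_ (Ordinal kM) (Ordinal lM)) := mulmx1C BA.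
rewrite !mxE -[RHS]/((k == l)%:R) => e.
transitivity (b%:R ^+ M * (k == l)%:R : R[i]); last first.
  by case: eqP => _; rewrite ?mulr1 ?mulr0.
rewrite -e mulr_sumr; apply: eq_bigr => j _; rewrite !mxE/=.
by rewrite [RHS]mulrCA mulVKf.
Qed.

(** Multi-indices with all coordinates below b^M come from finite functions, so that a product over
    coordinates of finite sums expands into one sum over a finite type. *)
Definition box_index M (t : {ffun 'I_s -> 'I_(b ^ M)}) : s.-tuple nat :=
  [tuple (t j : nat) | j < s].

Definition grid_point M (q : {ffun 'I_s -> 'I_(b ^ M)}) : Rvec R s :=
  [tuple (grid R b M (q j) : measurableTypeR R) | j < s].

Definition cell M (q : {ffun 'I_s -> 'I_(b ^ M)}) : set (Rvec R s) :=
  [set x | cube x /\ forall j, level b M (tnth x j) = q j].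

Lemma box_index_inj M : injective (@box_index M).
Proof.
move=> t t' e; apply/ffunP => j; apply: val_inj.
by have := congr1 (fun u => tnth u j) e; rewrite !tnth_mktuple.
Qed.

Lemma box_indexP M (l : s.-tuple nat) : (forall j, tnth l j < b ^ M)%N ->
  exists t : {ffun 'I_s -> 'I_(b ^ M)}, l = box_index t.
Proof.
move=> lM; exists [ffun j => Ordinal (lM j)]; apply: eq_from_tnth => j.
by rewrite tnth_mktuple ffunE.
Qed.

Lemma cell_grid M q : cell q (@grid_point M q).
Proof.
split=> j; rewrite tnth_mktuple; last by rewrite level_grid.
exact: grid_itv.
Qed.

Lemma grid_cube M q : cube (@grid_point M q).
Proof. by case: (cell_grid q). Qed.

Lemma cell_exists M (x : Rvec R s) : cube x ->
  exists q : {ffun 'I_s -> 'I_(b ^ M)}, cell q x.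
Proof.
move=> cx; exists [ffun j => Ordinal (level_lt b_gt1 M (cx j))].
by split=> // j; rewrite ffunE.
Qed.

Lemma cell_inj M (q q' : {ffun 'I_s -> 'I_(b ^ M)}) (x : Rvec R s) :
  cell q x -> cell q' x -> q = q'.
Proof.
move=> [_ e] [_ e']; apply/ffunP => j; apply: val_inj.
by rewrite /= -e -e'.
Qed.

Lemma wal_cell M (t q : {ffun 'I_s -> 'I_(b ^ M)}) (x : Rvec R s) : cell q x ->
  wal b (box_index t) x = wal b (box_index t) (grid_point q).
Proof.
move=> qx; rewrite /wal; apply: eq_bigr => j _; have [cx e] := qx.
have /andP[g0 _] := @grid_cube M q j.
have /andP[x0 _] := cx j.
apply: (@wal1_level M) => //; first by rewrite tnth_mktuple.
by rewrite e tnth_mktuple level_grid.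
Qed.

Lemma wal_orthogonal M (k l : {ffun 'I_s -> 'I_(b ^ M)}) :
  \sum_(q : {ffun 'I_s -> 'I_(b ^ M)})
     wal b (box_index k) (grid_point q) *
     conjc (wal b (box_index l) (grid_point q)) =
  (if k == l then (b%:R ^+ M) ^+ s else 0).
Proof.
transitivity (\prod_(j < s) \sum_(q < b ^ M)
    wal1 b (k j) (grid R b M q) * conjc (wal1 b (l j) (grid R b M q))).
  rewrite bigA_distr_bigA/=; apply: eq_bigr => q _.
  rewrite /wal rmorph_prod -big_split/=; apply: eq_bigr => j _.
  by rewrite !tnth_mktuple.
rewrite (eq_bigr _ (fun j _ => wal1_orthogonal (ltn_ord (k j)) (ltn_ord (l j)))).
case: eqP => [->|kl].
  by under eq_bigr do rewrite eqxx; rewrite prodr_const card_ord.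
have /existsP[j klj] : [exists j, k j != l j].
  rewrite -negb_forall; apply: contra_notN kl => /forallP h.
  by apply/ffunP => j; exact/eqP.
by rewrite (bigD1 j)//= ifN ?mul0r.
Qed.

Definition multi_kfactor (l i : s.-tuple nat) : R :=
  \prod_(j < s) kfactor R b (tnth l j) (tnth i j).

(* Inverse of the volume of D_i. *)
Definition Dset_density (i : s.-tuple nat) : R :=
  \prod_(j < s) (b%:R ^+ (tnth i j).+1 / (b%:R - 1)).

Lemma Dset_density_gt0 (i : s.-tuple nat) : 0 < Dset_density i.
Proof.
apply: prodr_gt0 => j _; rewrite divr_gt0 ?exprn_gt0 ?ltr0n//.
by rewrite subr_gt0 ltr1n.
Qed.

(** The product over the coordinates of the expansions in [sum_walsh_kfactor], multiplied out. *)
Lemma Dset_expansion M (i : s.-tuple nat) (z : Rvec R s * Rvec R s) :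
  (forall j, tnth i j < M)%N -> cube2 z ->
  \sum_(t : {ffun 'I_s -> 'I_(b ^ M)}) (multi_kfactor (box_index t) i)%:C%C *
     (wal b (box_index t) z.1 * conjc (wal b (box_index t) z.2)) =
  (Dset_density i * \1_(Dset b i) z)%:C%C.
Proof.
case: z => x y iM [/= cx cy].
pose F j (l : 'I_(b ^ M)) := (kfactor R b l (tnth i j))%:C%C *
  (wal1 b l (tnth x j) * conjc (wal1 b l (tnth y j))).
transitivity (\prod_(j < s) \sum_(l < b ^ M) F j l).
  rewrite bigA_distr_bigA/=; apply: eq_bigr => t _.
  rewrite /wal /multi_kfactor !rmorph_prod -!big_split/=; apply: eq_bigr => j _.
  by rewrite /F !tnth_mktuple.
rewrite (eq_bigr _ (fun j _ => sum_walsh_kfactor b_gt1 (cx j) (cy j) (iM j))).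
rewrite indicE; have [/set_mem|/negP] := boolP ((x, y) \in Dset b i).
  move=> [_ /= D]; rewrite mulr1 rmorph_prod; apply: eq_bigr => j _.
  have [[x0 _] [y0 _]] := (andP (cx j), andP (cy j)).
  have /(common_digitsE b _ x0 y0) -> := D j.
  by rewrite rmorphM/= fmorphV/= rmorphXn/= rmorphB/= rmorph1 rmorph_nat.
rewrite mulr0 rmorph0 => nD.
have /existsP[j hj] : [exists j, ~~ (agree b (tnth i j) (tnth x j) (tnth y j) &&
    ~~ agree b (tnth i j).+1 (tnth x j) (tnth y j))].
  rewrite -negb_forall; apply/forallP => h; apply: nD; apply/mem_set.
  split=> // j /=; have [[x0 _] [y0 _]] := (andP (cx j), andP (cy j)).
  exact/common_digitsE.
by rewrite (bigD1 j)//= ifN ?mul0r.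
Qed.

End multivariate.
Arguments cell R {b s M} q _.
Arguments grid_point R {b s M} q.

(** * Integrals of step functions *)

Section simple_integral.
Context d (T : measurableType d) (R : realType).
Variables (mu : {measure set T -> \bar R}) (D : set T) (mD : measurable D).

Lemma integrable_indic_fin (A : set T) : measurable A -> (mu (A `&` D) < +oo)%E ->
  mu.-integrable D (EFin \o \1_A).
Proof.
move=> mA A_fin; apply/integrableP; split.
  exact/measurable_EFinP/measurable_indic.
under eq_integral => x _ do rewrite /= ger0_norm//.
by rewrite integral_indic.
Qed.

Variables (I : finType) (A : I -> set T) (c : I -> R) (f : T -> R).
Hypothesis mA : forall i, measurable (A i).
Hypothesis A_fin : forall i, (mu (A i `&` D) < +oo)%E.
Hypothesis fE : forall x, D x -> f x = \sum_i c i * \1_(A i) x.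

Let fE' : {in D, (fun x => (\sum_i ((c i)%:E * (\1_(A i) x)%:E))%E) =1 EFin \o f}.
Proof. by move=> x /set_mem Dx; rewrite /= fE// -sumEFin. Qed.

Let int_term i : mu.-integrable D (fun x => ((c i)%:E * (\1_(A i) x)%:E)%E).
Proof. exact/integrableZl/integrable_indic_fin. Qed.

Lemma simple_integrable : mu.-integrable D (EFin \o f).
Proof. by apply: (@eq_integrable _ _ _ mu D mD _ _ fE'); exact: integrable_sum. Qed.

Lemma simple_integral :
  (\int[mu]_(x in D) (f x)%:E = \sum_i ((c i)%:E * mu (A i `&` D)))%E.
Proof.
rewrite -(eq_integral _ _ fE') integral_sum//.
apply: eq_bigr => i _; rewrite integralZl ?integral_indic//.
exact: integrable_indic_fin.
Qed.

End simple_integral.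

(** * Functions constant on b-adic cells *)

Section cells.
Variables (R : realType) (b s : nat).
Hypothesis b_gt1 : (1 < b)%N.

Let b_gt0 : (0 < b)%N := ltnW b_gt1.

Section level.
Variable M : nat.
Local Notation box := {ffun 'I_s -> 'I_(b ^ M)}.

Let bM : 0 < b%:R ^+ M :> R.
Proof. by rewrite exprn_gt0// ltr0n. Qed.

Let side (q : box) j : set (measurableTypeR R) :=
  [set` `[(q j)%:R / b%:R ^+ M, (q j).+1%:R / b%:R ^+ M[%R].

Let measurable_side q j : measurable (side q j).
Proof. exact: measurable_itv. Qed.

Let cellE (q : box) : cell R q = [set x | forall j, side q j (tnth x j)].
Proof.
have q0 j : 0 <= (q j)%:R / b%:R ^+ M :> R by rewrite divr_ge0// ltW.
apply/seteqP; split=> x /=; rewrite /side.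
  move=> [cx e] j; rewrite /= in_itv/= -level_itv//; first exact/eqP.
  by case/andP: (cx j).
move=> h; have h' j : 0 <= tnth x j.
  by have := h j; rewrite /= in_itv/= => /andP[+ _]; exact: le_trans.
split=> j; have := h j; rewrite /= in_itv/=.
  rewrite h' => /andP[_ /lt_le_trans]; apply.
  by rewrite ler_pdivrMr// mul1r -natrX ler_nat.
by rewrite -level_itv// => /eqP.
Qed.

Lemma measurable_cell (q : box) : measurable (cell R q).
Proof. by rewrite cellE; exact: (measurable_tuple_box (measurable_side q)). Qed.

Lemma lebesgue_cell (q : box) :
  lebesgue_tuple R s (cell R q) = ((b%:R ^+ M) ^- s)%:E.
Proof.
rewrite cellE (lebesgue_tuple_box (measurable_side q)).
rewrite (eq_bigr (fun=> ((b%:R ^+ M)^-1)%:E)).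
  by rewrite prodEFin prodr_const card_ord exprVn.
move=> j _; rewrite /side lebesgue_measure_itv/= lte_fin ltr_pM2r ?invr_gt0//.
rewrite ltr_nat ltnSn.
by rewrite -EFinB -mulrBl -natrB// subSnn mul1r.
Qed.

Definition cell2 (pq : box * box) : set (Rvec R s * Rvec R s) :=
  cell R pq.1 `*` cell R pq.2.

Lemma measurable_cell2 pq : measurable (cell2 pq).
Proof. by apply: measurableX; exact: measurable_cell. Qed.

Lemma lebesgue_cell2 pq :
  (lebesgue2 R s (cell2 pq) = ((b%:R ^+ M) ^- (2 * s))%:E)%E.
Proof.
transitivity
  (lebesgue_tuple R s (cell R pq.1) * lebesgue_tuple R s (cell R pq.2))%E.
  by apply: product_measure1E; exact: measurable_cell.
by rewrite !lebesgue_cell -EFinM -invfM -exprD mul2n addnn.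
Qed.

Lemma cell2_cube pq : cell2 pq `<=` cube2.
Proof. by move=> z [[cx _] [cy _]]. Qed.

Definition grid_pair (pq : box * box) : Rvec R s * Rvec R s :=
  (grid_point R pq.1, grid_point R pq.2).

(** Constancy on products of two cells, stated through the value at the pair of lower corners. The
    codomain is arbitrary, so that sets, as functions to Prop, are covered too. *)
Definition cellwise (V : Type) (f : Rvec R s * Rvec R s -> V) :=
  forall pq z, cell2 pq z -> f z = f (grid_pair pq).

Lemma cellwise_sum (f : Rvec R s * Rvec R s -> R) z : cellwise f -> cube2 z ->
  f z = \sum_pq f (grid_pair pq) * \1_(cell2 pq) z.
Proof.
move=> fc [/(cell_exists b_gt1 M)[p zp] /(cell_exists b_gt1 M)[q zq]].
have pqz : cell2 (p, q) z by [].
rewrite (bigD1 (p, q))//= big1 ?addr0.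
  by rewrite indicE mem_set// mulr1; exact: fc.
move=> [p' q'] h; rewrite indicE memNset ?mulr0// => -[/= zp' zq'].
by move: h; rewrite (cell_inj zp zp') (cell_inj zq zq') eqxx.
Qed.

(** Such a set is a finite union of products of cells. *)
Lemma measurable_cellwise (D : set (Rvec R s * Rvec R s)) :
  D `<=` cube2 -> cellwise D -> measurable D.
Proof.
move=> D1 Dc.
rewrite (_ : D = \bigcup_(pq in [set pq | D (grid_pair pq)]) cell2 pq).
  by apply: fin_bigcup_measurable => // pq _; exact: measurable_cell2.
apply/seteqP; split=> z /=.
  move=> Dz; have [] := D1 _ Dz.
  move=> /(cell_exists b_gt1 M)[p zp] /(cell_exists b_gt1 M)[q zq].
  by exists (p, q) => //=; rewrite -(Dc (p, q) z).
by move=> [pq /= Dpq zpq]; rewrite (Dc _ _ zpq).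
Qed.

Let cell2I pq : cell2 pq `&` cube2 = cell2 pq.
Proof. by apply/setIidPl; exact: cell2_cube. Qed.

Let cell2_fin pq : (lebesgue2 R s (cell2 pq `&` cube2) < +oo)%E.
Proof. by rewrite cell2I lebesgue_cell2 ltry. Qed.

Lemma measurable_cube2 : measurable (@cube2 R s).
Proof.
have cubeE (x : Rvec R s) : cube x <-> forall j, [set` `[0, 1[%R] (tnth x j).
  by split=> h j; have := h j; rewrite /= in_itv.
rewrite /cube2.
rewrite (_ : cube = [set x | forall j, [set` `[0, 1[%R] (tnth x j)]); last first.
  by apply/seteqP; split=> x /cubeE.
by apply: measurableX; exact: (measurable_tuple_box (fun j => measurable_itv _)).
Qed.

Lemma integrable_cellwise f : cellwise f ->
  (lebesgue2 R s).-integrable cube2 (EFin \o f).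
Proof.
move=> fc; exact: (@simple_integrable _ _ _ (lebesgue2 R s) _ measurable_cube2
  _ _ _ f measurable_cell2 cell2_fin (fun x => cellwise_sum fc)).
Qed.

Lemma Rintegral_cellwise f : cellwise f ->
  \int[lebesgue2 R s]_(z in cube2) f z =
  (b%:R ^+ M) ^- (2 * s) * \sum_pq f (grid_pair pq).
Proof.
move=> fc; rewrite /Rintegral.
rewrite (@simple_integral _ _ _ (lebesgue2 R s) _ measurable_cube2
  _ _ _ f measurable_cell2 cell2_fin (fun x => cellwise_sum fc)).
rewrite (eq_bigr (fun pq => ((b%:R ^+ M) ^- (2 * s) * f (grid_pair pq))%:E)).
  by rewrite sumEFin/= mulr_sumr.
move=> pq _; rewrite cell2I mulrC EFinM; congr (_ * _)%E.
exact: lebesgue_cell2.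
Qed.

(** The componentwise complex integral, in the form used by [walsh_coef], which is convertible to an
    instance of it. *)
Definition Cintegral (f : Rvec R s * Rvec R s -> R[i]) : R[i] :=
  Complex (\int[lebesgue2 R s]_(z in cube2) complex.Re (f z))
          (\int[lebesgue2 R s]_(z in cube2) complex.Im (f z)).

Lemma Cintegral_cellwise f : cellwise f ->
  Cintegral f = (b%:R ^+ M) ^- (2 * s) * \sum_pq f (grid_pair pq).
Proof.
move=> fc; rewrite /Cintegral !Rintegral_cellwise; last 2 first.
- by move=> pq z /fc ->.
- by move=> pq z /fc ->.
rewrite (_ : (b%:R ^+ M) ^- (2 * s) = ((b%:R ^+ M) ^- (2 * s))%:C%C :> R[i]);
  last first.
  by rewrite fmorphV/= !rmorphXn/= rmorph_nat.
rewrite (_ : \sum_pq f _ = Complex (\sum_pq complex.Re (f (grid_pair pq)))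
    (\sum_pq complex.Im (f (grid_pair pq)))); last first.
  elim/big_ind3: _ => [//|x1 x2 x3 y1 y2 y3 -> ->//|pq _]; by case: (f _).
by apply/eqP; rewrite eq_complex /= !mul0r subr0 addr0 !eqxx.
Qed.

End level.
End cells.
Arguments measurable_cube2 {R s}.

(** * Mixtures of uniform densities on the sets D_i *)

Section mixture.
Variables (R : realType) (b s : nat).
Hypothesis b_gt1 : (1 < b)%N.

Let b_gt0 : (0 < b)%N := ltnW b_gt1.

Variables (I : finType) (w : I -> R) (gam : I -> s.-tuple nat).

(** The index type is abstract: pairs of net points give the joint density, and [unit] gives the
    density of a single D_i. *)
Definition mixture (z : Rvec R s * Rvec R s) : R :=
  \sum_i w i * (Dset_density R b (gam i) * \1_(Dset b (gam i)) z).

Definition mixture_coef (t : s.-tuple nat) : R :=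
  \sum_i w i * multi_kfactor R b t (gam i).

(** At coordinate j both indicators in [kfactor] are 0, since t_j >= b^M and the exponents i_j and
    i_j + 1 are at most M. *)
Lemma mixture_coef_small M t j : (forall i j, tnth (gam i) j < M)%N ->
  (b ^ M <= tnth t j)%N -> mixture_coef t = 0.
Proof.
move=> gamM tM; rewrite /mixture_coef big1// => i _.
have h k : (k <= M)%N -> (tnth t j < b ^ k)%N = false.
  move=> kM; apply/negbTE; rewrite -leqNgt; apply: leq_trans tM.
  by rewrite leq_exp2l.
rewrite /multi_kfactor (bigD1 j)//= /kfactor.
by rewrite (h _ (gamM i j)) (h _ (ltnW (gamM i j))) mulr0 subrr !mul0r mulr0.
Qed.

Section level.
Variable M : nat.
Hypothesis gamM : forall i j, (tnth (gam i) j < M)%N.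
Local Notation box := {ffun 'I_s -> 'I_(b ^ M)}.

Lemma mixture_expansion z : cube2 z ->
  (mixture z)%:C%C = \sum_(t : box) (mixture_coef (box_index t))%:C%C *
    (wal b (box_index t) z.1 * conjc (wal b (box_index t) z.2)).
Proof.
move=> cz; rewrite /mixture rmorph_sum/=.
under [RHS]eq_bigr => t _ do rewrite rmorph_sum mulr_suml.
rewrite exchange_big/=; apply: eq_bigr => i _.
rewrite rmorphM/= -(Dset_expansion b_gt1 (gamM i) cz) mulr_sumr.
by apply: eq_bigr => t _; rewrite [in RHS]rmorphM -mulrA.
Qed.

(** The expansion involves only Walsh functions of index below b^M, which see only the first M
    digits of each coordinate. *)
Lemma mixture_cellwise : cellwise b M mixture.
Proof.
move=> [p q] z zpq; apply: (@complexI R).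
have gc : cube2 (grid_pair R (p, q)) by split; exact: grid_cube.
rewrite !mixture_expansion//; last exact: cell2_cube zpq.
apply: eq_bigr => t _; have [zp zq] := zpq.
by rewrite (wal_cell b_gt1 t zp) (wal_cell b_gt1 t zq).
Qed.

End level.

Lemma index_bound (k : s.-tuple nat) : exists K, forall j, (tnth k j < b ^ K)%N.
Proof.
exists (\max_(j < s) ndigits b (tnth k j)) => j.
by rewrite -ndigits_leq//; exact: leq_bigmax.
Qed.

Lemma wal_cellwise M (k l : s.-tuple nat) :
  (forall j, tnth k j < b ^ M)%N -> (forall j, tnth l j < b ^ M)%N ->
  cellwise b M (fun z : Rvec R s * Rvec R s =>
    conjc (wal b k z.1 * conjc (wal b l z.2))).
Proof.
move=> /box_indexP[k' ->] /box_indexP[l' ->] [p q] z [zp zq].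
by rewrite (wal_cell b_gt1 k' zp) (wal_cell b_gt1 l' zq).
Qed.

(** On a fine enough grid the integral is a finite sum. Expanding the mixture, the sum over each t
    factors into two Walsh inner products, which vanish unless t = k and t = l. *)
Lemma walsh_coef_mixture M (k l : s.-tuple nat) :
  (forall i j, tnth (gam i) j < M)%N ->
  walsh_coef b mixture k l = (if k == l then (mixture_coef l)%:C%C else 0).
Proof.
move=> gamM.
have [K kK] := index_bound k; have [L lL] := index_bound l.
(* A resolution at which the mixture and both Walsh functions are constant on cells. *)
pose N := maxn M (maxn K L).
have gamN i j : (tnth (gam i) j < N)%N by rewrite leq_max gamM.
have kN j : (tnth k j < b ^ N)%N.
  by apply: leq_trans (kK j) _; rewrite leq_exp2l// !leq_max leqnn orbT.
have lN j : (tnth l j < b ^ N)%N.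
  by apply: leq_trans (lL j) _; rewrite leq_exp2l// !leq_max leqnn !orbT.
rewrite -[LHS]/(Cintegral (fun z => (mixture z)%:C%C *
  conjc (wal b k z.1 * conjc (wal b l z.2)))).
rewrite (@Cintegral_cellwise _ _ _ b_gt1 N); last first.
  by move=> pq z zpq; rewrite (mixture_cellwise gamN zpq) (wal_cellwise kN lN zpq).
have [k' kE] := box_indexP kN; have [l' lE] := box_indexP lN.
pose W (t q : {ffun 'I_s -> 'I_(b ^ N)}) := wal b (box_index t) (grid_point R q).
have bN : b%:R ^+ N != 0 :> R[i] by rewrite expf_neq0// pnatr_eq0 -lt0n.
transitivity ((b%:R ^+ N) ^- (2 * s) * \sum_t (mixture_coef (box_index t))%:C%C *
  ((\sum_p W t p * conjc (W k' p)) * (\sum_q W l' q * conjc (W t q)))).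
  congr (_ * _).
  rewrite (eq_bigr (fun pq => \sum_t (mixture_coef (box_index t))%:C%C *
    ((W t pq.1 * conjc (W k' pq.1)) * (W l' pq.2 * conjc (W t pq.2))))); last first.
    move=> [p q] _.
    rewrite (mixture_expansion gamN); last by split; exact: grid_cube.
    rewrite mulr_suml; apply: eq_bigr => t _.
    rewrite kE lE/= -/(W t p) -/(W t q) -/(W k' p) -/(W l' q) rmorphM/= conjcK.
    by ring.
  rewrite exchange_big/=; apply: eq_bigr => t _; rewrite -mulr_sumr; congr (_ * _).
  rewrite mulr_suml -(pair_bigA _ (fun p q =>
    (W t p * conjc (W k' p)) * (W l' q * conjc (W t q))))/=.
  by apply: eq_bigr => p _; rewrite mulr_sumr.
under eq_bigr => t _ do rewrite !(wal_orthogonal R b_gt1).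
rewrite (bigD1 l')//= [X in _ + X]big1 ?addr0; last first.
  by move=> t tl; rewrite [l' == t]eq_sym (negbTE tl) !mulr0.
rewrite eqxx kE lE (inj_eq (@box_index_inj b s N)) eq_sym.
case: eqP => _; last by rewrite mul0r !mulr0.
by rewrite -lE mulrCA -exprD addnn -mul2n mulVf ?mulr1// expf_neq0.
Qed.

End mixture.

Lemma measure_bigcup_finType d (T : measurableType d) (R : realType)
    (mu : {measure set T -> \bar R}) (I : finType) (F : I -> set T) :
  (forall i, measurable (F i)) -> trivIset setT F ->
  (mu (\bigcup_i F i) = \sum_i mu (F i))%E.
Proof.
move=> mF tF; rewrite measure_fin_bigcup//; last exact: finite_finset.
rewrite (_ : setT = [set` index_enum I]) -?fsbig_seq ?index_enum_uniq//.
by apply/seteqP; split=> i _ //=; rewrite mem_index_enum.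
Qed.

(** * Measurability and volume of the sets D_i *)

Section Dset_measure.
Variables (R : realType) (b s : nat).
Hypothesis b_gt1 : (1 < b)%N.

Let b_gt0 : (0 < b)%N := ltnW b_gt1.

(** The mixture with one component of weight 1, through which results on mixtures yield facts about
    a single D_i. *)
Let mix1 (i : s.-tuple nat) := @mixture R b s unit (fun=> 1) (fun=> i).

Let mix1E i z : mix1 i z = Dset_density R b i * \1_(Dset b i) z.
Proof. by rewrite /mix1 /mixture (big_pred1 tt) ?mul1r// => -[]. Qed.

(** The indicator of D_i is cellwise, because a nonzero multiple of it is a mixture. *)
Lemma measurable_Dset (i : s.-tuple nat) : measurable (@Dset R b s i).
Proof.
have [M iM] : exists M, forall j, (tnth i j < M)%N.
  by exists (\max_(j < s) tnth i j).+1 => j; rewrite ltnS leq_bigmax.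
apply: (@measurable_cellwise _ _ _ b_gt1 M); first by move=> z [].
move=> pq z zpq.
have := @mixture_cellwise R b s b_gt1 unit (fun=> 1) (fun=> i) M (fun=> iM)
  pq z zpq.
rewrite -!/(mix1 i _) !mix1E => /(mulfI (lt0r_neq0 (Dset_density_gt0 R b_gt1 i))).
rewrite !indicE => /eqP; rewrite eqr_nat => /eqP/= e.
apply/propext; split=> /mem_set h; apply/set_mem; move: e; rewrite h;
  by case: (_ \in _).
Qed.
Arguments measurable_Dset i : clear implicits.

Lemma kfactor0 i : kfactor R b 0 i = 1.
Proof.
rewrite /kfactor !expn_gt0 b_gt0/= mulr1 divff// subr_eq0.
by rewrite -[1]/(1%:R) eqr_nat; case: b b_gt1 => [|[]].
Qed.

Lemma multi_kfactor0 (i : s.-tuple nat) : multi_kfactor R b mzero_idx i = 1.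
Proof.
by rewrite /multi_kfactor big1// => j _; rewrite tnth_mktuple kfactor0.
Qed.

Lemma walsh_coef0 (psi : Rvec R s * Rvec R s -> R) :
  walsh_coef b psi mzero_idx mzero_idx =
  (\int[lebesgue2 R s]_(z in cube2) psi z)%:C%C.
Proof.
have wal0 (x : Rvec R s) : wal b mzero_idx x = 1 :> R[i].
  by rewrite /wal big1// => j _; rewrite tnth_mktuple wal1_0.
rewrite /walsh_coef (@eq_Rintegral _ _ _ _ _ psi) ?[X in Complex _ X](_ : _ = 0)//.
  rewrite (@eq_Rintegral _ _ _ _ _ (cst 0)); last first.
    by move=> z _; rewrite !wal0 conjc1 mulr1 conjc1 mulr1.
  by rewrite /Rintegral integral0.
by move=> z _; rewrite !wal0 conjc1 mulr1 conjc1 mulr1.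
Qed.

(** The integral of [mix1 i] is its Walsh coefficient at index 0, which is 1 because [kfactor] is 1
    there. Hence [Dset_density] times the volume is 1. *)
Lemma lebesgue2_Dset (i : s.-tuple nat) :
  (lebesgue2 R s (Dset b i) = ((Dset_density R b i)^-1)%:E)%E.
Proof.
have [M iM] : exists M, forall j, (tnth i j < M)%N.
  by exists (\max_(j < s) tnth i j).+1 => j; rewrite ltnS leq_bigmax.
have d0 := Dset_density_gt0 R b_gt1 i.
have := @walsh_coef_mixture R b s b_gt1 unit (fun=> 1) (fun=> i) M
  mzero_idx mzero_idx (fun=> iM).
rewrite eqxx /mixture_coef (big_pred1 tt) => [|[]//].
rewrite mul1r multi_kfactor0 walsh_coef0 => /(@complexI R).
have int1 : (lebesgue2 R s).-integrable cube2 (EFin \o mix1 i).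
  apply: (integrable_cellwise b_gt1 (M := M)).
  exact: (@mixture_cellwise R b s b_gt1 unit (fun=> 1) (fun=> i) M (fun=> iM)).
move=> int_eq; have := congr1 EFin int_eq; rewrite /Rintegral fineK; last first.
  exact: (integrable_fin_num measurable_cube2 int1).
have -> : (\int[lebesgue2 R s]_(z in cube2) (mix1 i z)%:E =
    \int[lebesgue2 R s]_(z in cube2)
      ((Dset_density R b i)%:E * (\1_(Dset b i) z)%:E))%E.
  by apply: eq_integral => z _; rewrite mix1E.
rewrite (ge0_integralZl _ measurable_cube2); last 3 first.
- by apply/measurable_EFinP/measurable_indic; exact: measurable_Dset.
- by move=> z _; rewrite lee_fin.
- by rewrite lee_fin ltW.
rewrite (integral_indic _ measurable_cube2); last exact: measurable_Dset.
rewrite (_ : Dset b i `&` cube2 = Dset b i); last first.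
  by apply/setIidPl => z [].
move=> h; rewrite -[LHS]mul1e -[X in (X%:E * _)%E](mulVf (lt0r_neq0 d0)).
by rewrite EFinM -muleA h mule1.
Qed.

End Dset_measure.
Arguments measurable_Dset R {b s}.

(** * The joint density *)

Section joint_law.
Variables (R : realType) (b s m : nat).
Hypothesis b_gt1 : (1 < b)%N.
Variables (d : measure_display) (Omega : measurableType d).
Variable P : probability Omega R.
Variables (V : 'I_(b ^ m) -> Rvec R s) (U : 'I_(b ^ m) -> Omega -> Rvec R s).
Variables I J : Omega -> 'I_(b ^ m).
Variable gam : 'I_(b ^ m) * 'I_(b ^ m) -> s.-tuple nat.
Hypothesis gamP : forall l j, l != j -> Dset b (gam (l, j)) (V l, V j).
Hypothesis scrU : is_scrambling P V U.
Hypothesis IJ_pair : is_random_pair P U I J.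

(** The law of [(I, J)]. *)
Definition pair_weight (n : nat) (lj : 'I_n * 'I_n) : R :=
  if lj.1 == lj.2 then 0 else (n%:R * (n%:R - 1))^-1.

(** Places the event in the sigma-algebra generated by [U], where the independence clause of
    [is_random_pair] applies. *)
Lemma g_sigma_preimage_pair l j (A : set (Rvec R s * Rvec R s)) : measurable A ->
  g_sigma_preimage U [set w | A (U l w, U j w)].
Proof.
move=> mA.
pose G := \big[setU/set0]_(i < b ^ m)
  preimage_set_system setT (U i) (@measurable _ (Rvec R s)).
have mU i : measurable_fun [set: g_sigma_algebraType G] (U i).
  move=> _ Y mY; apply: sub_sigma_algebra.
  by rewrite /G (bigD1 i)//=; left; exists Y.
have := measurable_fun_pair (mU l) (mU j) measurableT mA.
by rewrite setTI.
Qed.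

(** Split according to the value of [(I, J)]: independence factors each piece, and the scrambling
    makes the pair uniform on the corresponding D_i. *)
Lemma joint_law (A : set (Rvec R s * Rvec R s)) : measurable A ->
  (P [set w | A (U (I w) w, U (J w) w)] = \sum_lj
    ((pair_weight lj * Dset_density R b (gam lj))%:E *
     lebesgue2 R s (A `&` Dset b (gam lj))))%E.
Proof.
move=> mA.
pose E lj := [set w | I w = lj.1 /\ J w = lj.2].
pose B lj := [set w | A (U lj.1 w, U lj.2 w)].
have mB lj : measurable (B lj).
  have [_ Uunif _] := scrU.
  rewrite -[X in measurable X]setTI.
  exact: (measurable_fun_pair (proj1 (Uunif lj.1)) (proj1 (Uunif lj.2))).
have mE lj : measurable (E lj) by have [] := IJ_pair lj.1 lj.2.
rewrite (_ : [set w | _] = \bigcup_(lj in setT) (E lj `&` B lj)); last first.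
  apply/seteqP; split=> w /=; first by move=> h; exists (I w, J w).
  by move=> [[l j] _ [[/= -> ->]]].
rewrite measure_bigcup_finType; last 2 first.
- by move=> lj; exact: measurableI.
- by move=> [l j] [l' j'] _ _ [w [[[/= <- <-] _] [[/= <- <-] _]]].
apply: eq_bigr => -[l j] _.
have [_ PE indep] := IJ_pair l j.
rewrite [LHS]indep; last exact: g_sigma_preimage_pair.
rewrite [X in (X * _)%E]PE /pair_weight/= natrX.
case: eqP => [_|/eqP lj]; first by rewrite mul0r !mul0e.
have [_ _ /(_ _ _ _ lj (gamP lj))[_ /(_ _ mA)]] := scrU.
rewrite /B/= => ->; rewrite lebesgue2_Dset// EFinM -muleA; congr (_ * _)%E.
(* The extended inverse of a real is its real inverse only away from 0, hence the appeal to
   positivity. *)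
by rewrite inver gt_eqF ?invr_gt0 ?Dset_density_gt0// invrK muleC.
Qed.

End joint_law.

(** * Identification of the joint density and its coefficients *)

Section joint_pdf.
Variables (R : realType) (b s : nat).
Hypothesis b_gt1 : (1 < b)%N.

(** The right-hand side is shaped to match that of [joint_law]. *)
Lemma integral_mixture (I : finType) (w : I -> R) (gam : I -> s.-tuple nat)
    (D : set (Rvec R s * Rvec R s)) : measurable D ->
  (\int[lebesgue2 R s]_(z in D) (mixture b w gam z)%:E = \sum_i
    ((w i * Dset_density R b (gam i))%:E * lebesgue2 R s (D `&` Dset b (gam i))))%E.
Proof.
move=> mD; rewrite (@simple_integral _ _ _ (lebesgue2 R s) _ mD I
    (fun i => Dset b (gam i)) (fun i => w i * Dset_density R b (gam i))).
- by apply: eq_bigr => i _; rewrite setIC.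
- by move=> i; exact: measurable_Dset.
- move=> i; apply: (@le_lt_trans _ _ (lebesgue2 R s (Dset b (gam i)))).
    apply: measureIl => //; exact: measurable_Dset.
  by rewrite [X in (X < _)%E]lebesgue2_Dset// ltry.
- by move=> z _; rewrite /mixture; apply: eq_bigr => i _; rewrite mulrA.
Qed.

(** A density is only determined up to null sets; this transfers coefficients from the mixture to
    psi. *)
Lemma walsh_coef_ae (f g : Rvec R s * Rvec R s -> R) (k l : s.-tuple nat) :
  measurable_fun cube2 f -> measurable_fun cube2 g ->
  ae_eq (lebesgue2 R s) cube2 (EFin \o f) (EFin \o g) ->
  walsh_coef b f k l = walsh_coef b g k l.
Proof.
move=> mf mg fg.
have [K kK] := index_bound b_gt1 k; have [L lL] := index_bound b_gt1 l.
pose N := maxn K L.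
have kN j : (tnth k j < b ^ N)%N.
  by apply: leq_trans (kK j) _; rewrite leq_exp2l// leq_max leqnn.
have lN j : (tnth l j < b ^ N)%N.
  by apply: leq_trans (lL j) _; rewrite leq_exp2l// leq_max leqnn orbT.
pose W (z : Rvec R s * Rvec R s) := conjc (wal b k z.1 * conjc (wal b l z.2)).
have Wc : cellwise b N W by exact: wal_cellwise.
(* [h] will be the real or the imaginary part. *)
have mW (h : R[i] -> R) : measurable_fun cube2 (h \o W).
  have hWc : cellwise b N (h \o W) by move=> pq z zpq /=; rewrite (Wc _ _ zpq).
  by have /measurable_int/measurable_EFinP := integrable_cellwise b_gt1 hWc.
have mfW (u : Rvec R s * Rvec R s -> R) (h : R[i] -> R) : measurable_fun cube2 u ->
    measurable_fun cube2 (fun z => (u z * h (W z))%:E).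
  move=> mu; have mh := mW h.
  by apply/(@measurable_EFinP _ _ _ _ (u \* (h \o W))); exact: measurable_funM.
have intE (h : R[i] -> R) : \int[lebesgue2 R s]_(z in cube2) (f z * h (W z)) =
    \int[lebesgue2 R s]_(z in cube2) (g z * h (W z)).
  rewrite /Rintegral; congr fine; apply: ae_eq_integral.
  - exact: measurable_cube2.
  - exact: mfW.
  - exact: mfW.
  - by apply: filterS fg => z fgz Dz; have [->] := fgz Dz.
rewrite /walsh_coef -/W; congr Complex.
  transitivity (\int[lebesgue2 R s]_(z in cube2) (f z * complex.Re (W z))).
    apply: eq_Rintegral => z _; rewrite -/(W z).
    by case: (W z) => x y /=; rewrite mul0r subr0.
  rewrite intE; apply: eq_Rintegral => z _; rewrite -/(W z).
  by case: (W z) => x y /=; rewrite mul0r subr0.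
transitivity (\int[lebesgue2 R s]_(z in cube2) (f z * complex.Im (W z))).
  apply: eq_Rintegral => z _; rewrite -/(W z).
  by case: (W z) => x y /=; rewrite mul0r addr0.
rewrite intE; apply: eq_Rintegral => z _; rewrite -/(W z).
by case: (W z) => x y /=; rewrite mul0r addr0.
Qed.

Variables (m : nat) (d : measure_display) (Omega : measurableType d).
Variable P : probability Omega R.
Variables (V : 'I_(b ^ m) -> Rvec R s) (U : 'I_(b ^ m) -> Omega -> Rvec R s).
Variables (I J : Omega -> 'I_(b ^ m)) (psi : Rvec R s * Rvec R s -> R).
Variable gam : 'I_(b ^ m) * 'I_(b ^ m) -> s.-tuple nat.
Hypothesis gamP : forall l j, l != j -> Dset b (gam (l, j)) (V l, V j).
Variable M : nat.
Hypothesis gamM : forall lj j, (tnth (gam lj) j < M)%N.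
Hypothesis scrU : is_scrambling P V U.
Hypothesis IJ_pair : is_random_pair P U I J.
Hypothesis psiP : is_joint_pdf P U I J psi.

(** Both functions integrate to the law of the pair over every measurable subset of the cube. *)
Lemma joint_pdf_ae : ae_eq (lebesgue2 R s) cube2
  (EFin \o psi) (EFin \o mixture b (@pair_weight R _) gam).
Proof.
apply/ae_eq_sym.
have [mpsi _ psi_int] := psiP.
apply: integral_ae_eq.
- exact: measurable_cube2.
- exact: (integrable_cellwise b_gt1 (mixture_cellwise b_gt1 _ gamM)).
- exact/measurable_EFinP.
move=> E EC mE; rewrite integral_mixture//.
rewrite -(joint_law b_gt1 gamP scrU IJ_pair mE) psi_int//.
by rewrite (_ : E `&` cube2 = E)//; exact/setIidPl.
Qed.

Lemma walsh_coef_joint_pdf k l : walsh_coef b psi k l =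
  (if k == l then (mixture_coef b (@pair_weight R _) gam l)%:C%C else 0).
Proof.
have [mpsi _ _] := psiP.
rewrite (walsh_coef_ae _ _ mpsi _ joint_pdf_ae).
  exact: walsh_coef_mixture gamM.
apply/measurable_EFinP; apply: (measurable_int (lebesgue2 R s)).
exact: (integrable_cellwise b_gt1 (mixture_cellwise b_gt1 _ gamM)).
Qed.

End joint_pdf.

(** * Counting pairs of net points *)

(** Pascal's rule, summed. At x = -1 the first term vanishes, which evaluates alternating partial
    sums; at x = -b it lowers r + 1 to r. *)
Lemma sum_bin_partial (R : comNzRingType) (r N : nat) (x : R) :
  \sum_(u < N.+1) 'C(r.+1, u)%:R * x ^+ u =
  (1 + x) * \sum_(u < N) 'C(r, u)%:R * x ^+ u + 'C(r, N)%:R * x ^+ N.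
Proof.
elim: N => [|N IH]; first by rewrite big_ord_recr !big_ord0/= !bin0; ring.
rewrite big_ord_recr/= IH [in RHS]big_ord_recr/= binS natrD exprS; ring.
Qed.

Lemma subset_sum_binomial (R : comNzRingType) (T : finType) (S : {set T})
    (f : nat -> R) :
  \sum_(A : {set T} | A \subset S) f #|A| =
  \sum_(t < #|S|.+1) 'C(#|S|, t)%:R * f t.
Proof.
have cardA (A : {set T}) : A \subset S -> (#|A| < #|S|.+1)%N.
  by rewrite ltnS; exact: subset_leq_card.
rewrite (partition_big (fun A : {set T} => inord #|A| : 'I_#|S|.+1) xpredT)//=.
apply: eq_bigr => t _; rewrite -[X in X%:R * _]cards_draws.
rewrite -[X in X%:R * _]sum1_card natr_sum mulr_suml.
apply: eq_big => [A|A /andP[AS /eqP <-]]; last by rewrite mul1r inordK ?cardA.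
rewrite inE; case AS: (A \subset S) => //=.
by rewrite -val_eqE/= inordK ?cardA.
Qed.

(* Subtraction is truncated: the terms with K - t > m vanish, as there are then
   no two points of a net in a common box of total level K - t. *)
Lemma net_binomial_sum (R : comNzRingType) (b r m K : nat) :
  (0 < r)%N -> (r <= K)%N ->
  \sum_(t < r.+1) 'C(r, t)%:R *
    ((-1) ^+ t * b%:R ^+ (r - t) * (b%:R ^+ (m - (K - t)) - 1)) =
  (-1) ^+ r.+1 * (1 - b%:R) *
    \sum_(0 <= i < r - (K - m)) (- b%:R) ^+ i * 'C(r.-1, i)%:R :> R.
Proof.
case: r => // r _ rK; set c := (K - m)%N; set x : R := b%:R.
(* Substitute t = r + 1 - u, so that u is the exponent of the first power of b. *)
rewrite (reindex_inj rev_ord_inj)/=.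
have [rc|cr] := ltnP r.+1 c.
  rewrite (_ : r.+1 - c = 0)%N ?big_geq ?mulr0//; last by lia.
  apply: big1 => u _; rewrite (_ : m - _ = 0)%N ?expr0 ?subrr ?mulr0//.
  by rewrite /c in rc; lia.
(* [N] is the number of terms on the right. For u <= N the powers b^u and b^(m - (K - t)) multiply
   to b^E, independent of u; for u > N the second exponent is truncated to 0 and the term
   vanishes. *)
pose N := (r.+1 - c)%N; pose E := (r.+1 + m - K)%N.
have Nr : (N.+1 <= r.+2)%N by rewrite /N; lia.
pose F u := (-1) ^+ r.+1 * ('C(r.+1, u)%:R * (-1) ^+ u * x ^+ E -
  'C(r.+1, u)%:R * (- x) ^+ u) : R.
transitivity (\sum_(u < N.+1) F u).
  rewrite (big_ord_widen _ F Nr) [RHS]big_mkcond/=; apply: eq_bigr => u _.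
  have ur : (u <= r.+1)%N by rewrite -ltnS.
  rewrite subSS subKn// bin_sub//; case: ifPn => uN.
    rewrite /F mulrBr mulr1; set e := (m - _)%N.
    have Ee : (E = u + e)%N by rewrite /E /e; rewrite ltnS /N /c in uN; lia.
    have -> : (-1) ^+ (r.+1 - u) = (-1) ^+ r.+1 * (-1) ^+ u :> R.
      by rewrite -signr_odd oddB// signr_addb !signr_odd.
    by rewrite Ee exprD (exprNn x u); ring.
  rewrite (_ : m - _ = 0)%N ?expr0 ?subrr ?mulr0//.
  by rewrite ltnS -ltnNge /N /c in uN; rewrite /c in cr; lia.
rewrite -mulr_sumr -mulrA [in RHS]exprS mulN1r mulNr -mulrN; congr (_ * _).
rewrite sumrB -mulr_suml !sum_bin_partial subrr mul0r add0r -/N big_mkord.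
(* The boundary terms of the two partial sums agree: either c > 0 and E = N, or c = 0 and N = r + 1
   makes the binomial coefficient 0. *)
have -> : 'C(r, N)%:R * (-1) ^+ N * x ^+ E = 'C(r, N)%:R * (- x) ^+ N.
  have [c0|c0] := posnP c; first by rewrite bin_small ?mul0r// /N c0; lia.
  rewrite (exprNn x) mulrA (_ : E = N)// /E /N; rewrite /c in c0 *; lia.
rewrite opprD addrCA subrr addr0; congr (- (_ * _)).
by apply: eq_bigr => u _; rewrite mulrC.
Qed.

(** Induction on the excess of the sum over m: a positive excess leaves a nonzero entry to lower by
    one. *)
Lemma sum_decrease (s m : nat) (f : 'I_s -> nat) : (m <= \sum_j f j)%N ->
  exists g : 'I_s -> nat, (forall j, g j <= f j)%N /\ (\sum_j g j = m)%N.
Proof.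
move=> /subnKC; move: (_ - m)%N => e.
elim: e f => [|e IH] f fE; first by exists f; split=> //; rewrite -fE addn0.
have [j fj] : exists j, (0 < f j)%N.
  apply/existsP; apply: contraPT fE => /existsPn f0.
  rewrite big1; first by rewrite addnS.
  by move=> j _; apply/eqP; rewrite -leqn0 leqNgt.
pose f' i := (f i - (i == j))%N.
have [|g [gf' gm]] := IH f'.
  apply/eqP; rewrite -eqSS -addnS fE (bigD1 j)//= [X in (_ == X.+1)%N](bigD1 j)//=.
  rewrite {1}/f' eqxx subn1 -addSn prednK// eqn_add2l; apply/eqP.
  by apply: eq_bigr => i /negbTE ij; rewrite /f' ij subn0.
by exists g; split=> // i; apply: leq_trans (gf' i) _; exact: leq_subr.
Qed.

(** * Net points sharing an elementary box *)

Section net_pairs.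
Variables (R : realType) (b s m : nat).
Hypothesis b_gt1 : (1 < b)%N.

Let b_gt0 : (0 < b)%N := ltnW b_gt1.

Variable V : 'I_(b ^ m) -> Rvec R s.
Hypothesis netV : is_net V.

Definition agree_all (k : 'I_s -> nat) (x y : Rvec R s) : bool :=
  [forall j, agree b (k j) (tnth x j) (tnth y j)].

Let V0 l j : 0 <= tnth (V l) j.
Proof. by case/andP: (netV.1 l j). Qed.

(** The points counted, [V l] included, are those in the elementary interval of resolution [k]
    around [V l]. *)
Lemma card_agree_all k l : (\sum_j k j <= m)%N ->
  #|[pred j | agree_all k (V l) (V j)]| = (b ^ (m - \sum_j k j))%N.
Proof.
move=> km.
have kE : (\sum_(j < s) tnth [tuple k j | j < s] j = \sum_j k j)%N.
  by apply: eq_bigr => j _; rewrite tnth_mktuple.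
have := netV.2 [tuple k j | j < s]; rewrite kE => /(_ km).
move=> /(_ [tuple level b (k j) (tnth (V l) j) | j < s]) h.
apply/eqP; rewrite -(eqr_nat R) natrX exprnP -subzn//.
rewrite kE in h; rewrite -h; last first.
  by move=> j; rewrite !tnth_mktuple level_lt//; exact: netV.1.
rewrite eqr_nat; apply/eqP/eq_card => j; rewrite !inE.
by apply: eq_forallb => i; rewrite !tnth_mktuple -level_itv//.
Qed.

(** For each of the b^m choices of l, count the other points in its box. Beyond total level m the
    truncated exponent makes the count 0. *)
Lemma card_agree_pairs (k : 'I_s -> nat) :
  (\sum_(lj | lj.1 != lj.2) (agree_all k (V lj.1) (V lj.2))%N =
   b ^ m * (b ^ (m - \sum_j k j) - 1))%N.
Proof.
have le_case (g : 'I_s -> nat) : (\sum_j g j <= m)%N ->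
    (\sum_(lj | lj.1 != lj.2) (agree_all g (V lj.1) (V lj.2))%N =
     b ^ m * (b ^ (m - \sum_j g j) - 1))%N.
  move=> gm; rewrite -(pair_big_dep xpredT (fun l j => l != j)
    (fun l j => nat_of_bool (agree_all g (V l) (V j))))/=.
  rewrite (eq_bigr (fun=> (b ^ (m - \sum_j g j) - 1)%N)).
    by rewrite sum_nat_const card_ord.
  move=> l _; rewrite -(card_agree_all l gm) -sum1_card [in RHS]big_mkcond/=.
  rewrite [in RHS](bigD1 l)//= inE.
  have -> : agree_all g (V l) (V l) by apply/forallP => j; exact: eqxx.
  rewrite addKn; apply: eq_big => j; first by rewrite eq_sym.
  by rewrite inE; case: agree_all.
have [/le_case//|mk] := leqP (\sum_j k j) m.
(* Beyond level m, coarsening k to a g of total level m already isolates the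
   points. *)
have [g [gk gm]] := sum_decrease (ltnW mk).
have -> : (m - \sum_j k j = 0)%N by lia.
rewrite expn0 subnn muln0; apply/eqP; rewrite -leqn0.
have := le_case g; rewrite gm leqnn => /(_ isT).
rewrite subnn expn0 subnn muln0 => /eq_leq; apply: leq_trans.
apply: leq_sum => -[l j] _ /=.
case a: (agree_all k _ _) => //; rewrite (_ : agree_all g _ _)//.
apply/forallP => i; move/forallP: a => /(_ i); exact: agree_leq.
Qed.

(** Each single coordinate separates the points at level m, so every gamma is finite and below m. *)
Lemma net_common_digits l j : l != j ->
  exists i : s.-tuple nat, Dset b i (V l, V j) /\ forall u, (tnth i u < m)%N.
Proof.
move=> lj.
have nagree u : ~~ agree b m (tnth (V l) u) (tnth (V j) u).
  (* Spending the whole level m on coordinate u gives boxes with exactly one point each. *)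
  apply/negP => a; pose k i := if i == u then m else 0%N.
  have km : (\sum_i k i = m)%N.
    rewrite (bigD1 u)//= big1 /k ?eqxx ?addn0// => i /negbTE -> //.
  have := @card_agree_all k l; rewrite km subnn => /(_ (leqnn _)) /eqP.
  move=> /card1P[x hx].
  have : l \in pred1 x.
    by rewrite -hx inE; apply/forallP => i; exact: eqxx.
  have : j \in pred1 x.
    rewrite -hx inE; apply/forallP => i; rewrite /k; case: eqP => [->//|_].
    by rewrite /agree !level0//; exact: netV.1.
  by rewrite !inE => /eqP jx /eqP lx; rewrite jx lx eqxx in lj.
have ex u : exists i, agree b i (tnth (V l) u) (tnth (V j) u) &&
    ~~ agree b i.+1 (tnth (V l) u) (tnth (V j) u) && (i < m)%N.
  (* The least level of disagreement is positive, as level 0 always agrees; its predecessor is the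
     value of gamma. *)
  have [k nk kmin] := ex_minnP (ex_intro
    (fun k => ~~ agree b k (tnth (V l) u) (tnth (V j) u)) _ (nagree u)).
  case: k nk kmin => [|k] nk kmin.
    by move: nk; rewrite /agree !level0 ?eqxx//; exact: netV.1.
  exists k; rewrite nk kmin ?nagree// !andbT.
  by apply: contraT => /kmin; rewrite ltnn.
have [i iP] := choice ex; exists [tuple i u | u < s].
split; last by move=> u; rewrite tnth_mktuple; case/andP: (iP u).
split=> [|u /=]; first by split; exact: netV.1.
rewrite tnth_mktuple; apply/common_digitsE => //.
by case/andP: (iP u).
Qed.

End net_pairs.

(** * The Walsh coefficients determined by a net *)

Section coefficients.
Variables (R : realType) (b s : nat).
Hypothesis b_gt1 : (1 < b)%N.

Let b_gt0 : (0 < b)%N := ltnW b_gt1.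

Let b1_neq0 : b%:R - 1 != 0 :> R.
Proof. by rewrite subr_eq0 -[1]/(1%:R) eqr_nat gtn_eqF. Qed.

Lemma ndigits_eq0 l : (ndigits b l == 0)%N = (l == 0)%N.
Proof. by rewrite -leqn0 ndigits_leq// expn0 ltnS leqn0. Qed.

Definition support (t : s.-tuple nat) : {set 'I_s} := [set u | tnth t u != 0%N].

Definition lowered_level (t : s.-tuple nat) (A : {set 'I_s}) (u : 'I_s) : nat :=
  ndigits b (tnth t u) - (u \in A).

(** With k = |t_u|, the numerator of [kfactor] is b [gamma >= k] - [gamma >= k - 1] for k > 0, and
    the factor is 1 for k = 0. In the expanded product, A collects the coordinates where the second
    term is chosen. *)
Lemma multi_kfactor_agree (t i : s.-tuple nat) (x y : Rvec R s) :
  Dset b i (x, y) -> multi_kfactor R b t i =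
  (b%:R - 1) ^- #|support t| * \sum_(A : {set 'I_s} | A \subset support t)
    (-1) ^+ #|A| * b%:R ^+ (#|support t| - #|A|) *
    (agree_all b (lowered_level t A) x y)%:R.
Proof.
move=> [[/= cx cy] Dxy].
have x0 u : 0 <= tnth x u by case/andP: (cx u).
have y0 u : 0 <= tnth y u by case/andP: (cy u).
pose k u := ndigits b (tnth t u).
pose ag n u : R := (agree b n (tnth x u) (tnth y u))%:R.
have kE u l : (tnth t u < b ^ l)%N = (k u <= l)%N by rewrite ndigits_leq.
(* Off the support the factor 1 is split as 0 + 1, so that only subsets A of the support
   contribute. *)
pose F u : R := if u \in support t then - ag (k u - 1)%N u else 0.
pose G u : R := if u \in support t then b%:R * ag (k u) u else 1.
transitivity (\prod_u
    ((if u \in support t then (b%:R - 1)^-1 else 1) * (F u + G u))).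
  apply: eq_bigr => u _; rewrite /kfactor !kE /F /G inE -ndigits_eq0 -/(k u).
  have [->|] := eqVneq (k u) 0%N; first by rewrite /= mulr1 divff// add0r mul1r.
  rewrite -lt0n => ku /=; rewrite /ag !(agree_common b_gt1 _ _ _ (Dxy u))//.
  by rewrite leq_subLR add1n addrC mulrC.
rewrite big_split/= -big_mkcond/= prodr_const exprVn; congr (_ * _).
rewrite bigA_distr/= [RHS]big_mkcond/=; apply: eq_bigr => A _.
have [At|/subsetPn[u uA ut]] := boolP (A \subset support t); last first.
  by rewrite (bigD1 u)//= uA /F (negbTE ut) mul0r.
transitivity (\prod_u ((if u \in A then -1 else 1) *
    (if u \in support t :\: A then b%:R else 1) * ag (lowered_level t A u) u)).
  apply: eq_bigr => u _; rewrite finset.in_setD /F /G /lowered_level -/(k u).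
  case uA: (u \in A) => /=; first by rewrite (fintype.subsetP At _ uA) mulr1 mulN1r.
  rewrite subn0 mul1r; case: ifP => //; rewrite inE -ndigits_eq0 -/(k u).
  by move/negbFE/eqP => ->; rewrite /ag /agree !level0// eqxx mulr1.
rewrite !big_split/= -!big_mkcond/= !prodr_const cardsD (finset.setIidPr At).
congr (_ * _).
case: (boolP (agree_all b _ x y)) => [/forallP h|/forallPn[u hu]].
  by rewrite big1// => u _; rewrite /ag h.
by rewrite (bigD1 u)//= /ag (negbTE hu) mul0r.
Qed.

Variables (m : nat) (V : 'I_(b ^ m) -> Rvec R s).
Hypothesis netV : is_net V.
Variable gam : 'I_(b ^ m) * 'I_(b ^ m) -> s.-tuple nat.
Hypothesis gamP : forall l j, l != j -> Dset b (gam (l, j)) (V l, V j).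

(** Summing [multi_kfactor_agree] over ordered pairs turns agreement indicators into pair counts.
    Their factor b^m cancels against the weight 1 / (n (n - 1)), and [net_binomial_sum] evaluates
    the rest. *)
Lemma net_mixture_coef (t : s.-tuple nat) : t != mzero_idx ->
  mixture_coef b (@pair_weight R _) gam t =
  - ((b ^ m)%:R - 1)^-1 * (1 - b%:R) ^ (1 - (nonzero_coords t)%:Z) *
      \sum_(0 <= i < nonzero_coords t - excess b m t)
        (- b%:R) ^+ i * 'C((nonzero_coords t).-1, i)%:R.
Proof.
move=> t0.
set r := nonzero_coords t; set K := (\sum_(j < s) ndigits b (tnth t j))%N.
have rE : #|support t| = r by rewrite cardsE.
have r_gt0 : (0 < r)%N.
  rewrite -rE card_gt0; apply: contraNneq t0 => S0; apply/eqP.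
  apply: eq_from_tnth => u; rewrite tnth_mktuple; apply/eqP/negPn.
  by have := finset.in_set0 u; rewrite -S0 inE => ->.
have rK : (r <= K)%N.
  rewrite -rE -sum1_card [X in (X <= _)%N]big_mkcond/=; apply: leq_sum => u _.
  by rewrite inE; case: ifP => // tu; rewrite lt0n ndigits_eq0.
have n0 : (b ^ m)%:R != 0 :> R by rewrite pnatr_eq0 -lt0n expn_gt0 b_gt0.
(* Every lowered coordinate lies in the support and has at least one digit, so no subtraction is
   truncated. *)
have sumK (A : {set 'I_s}) : A \subset support t ->
    (\sum_u lowered_level t A u = K - #|A|)%N.
  move=> At; rewrite /lowered_level sumnB.
    by rewrite -/K; congr (_ - _)%N; rewrite -sum1_card [RHS]big_mkcond.
  move=> u _; case uA: (u \in A) => //.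
  by have := fintype.subsetP At _ uA; rewrite inE lt0n ndigits_eq0.
transitivity (((b ^ m)%:R * ((b ^ m)%:R - 1))^-1 * ((b%:R - 1) ^- r *
   \sum_(A : {set 'I_s} | A \subset support t) (-1) ^+ #|A| * b%:R ^+ (r - #|A|) *
    ((b ^ m)%:R * (b%:R ^+ (m - (K - #|A|)) - 1)) : R)).
  rewrite /mixture_coef.
  rewrite (bigID (fun lj : 'I_(b ^ m) * 'I_(b ^ m) => lj.1 == lj.2))/=.
  rewrite big1 ?add0r; last by move=> lj h; rewrite /pair_weight h mul0r.
  rewrite (eq_bigr (fun lj => ((b ^ m)%:R * ((b ^ m)%:R - 1))^-1 *
    ((b%:R - 1) ^- r *
    \sum_(A : {set 'I_s} | A \subset support t) (-1) ^+ #|A| * b%:R ^+ (r - #|A|) *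
    (agree_all b (lowered_level t A) (V lj.1) (V lj.2))%:R))); last first.
    move=> [l j] lj; rewrite /pair_weight (negbTE lj); congr (_ * _).
    by rewrite (multi_kfactor_agree t (gamP lj)) rE.
  rewrite -mulr_sumr -mulr_sumr exchange_big/=; do 2 congr (_ * _).
  apply: eq_bigr => A At; rewrite -mulr_sumr -natr_sum card_agree_pairs//.
  by rewrite natrM sumK// natrB ?expn_gt0 ?b_gt0// !natrX.
rewrite (subset_sum_binomial (support t) (fun a => (-1) ^+ a * b%:R ^+ (r - a) *
    ((b ^ m)%:R * (b%:R ^+ (m - (K - a)) - 1)))) rE.
rewrite (eq_bigr (fun a : 'I_r.+1 => (b ^ m)%:R * ('C(r, a)%:R *
    ((-1) ^+ a * b%:R ^+ (r - a) * (b%:R ^+ (m - (K - a)) - 1))))); last first.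
  by move=> a _; ring.
rewrite -mulr_sumr net_binomial_sum//.
rewrite -/(excess b m t) -/r.
set S := \sum_(0 <= i < _) _.
have -> : (1 - b%:R) ^ (1 - r%:Z) = (1 - b%:R) * (1 - b%:R) ^- r :> R.
  rewrite expfzDr; last by rewrite -opprB oppr_eq0.
  by rewrite expr1z exprnN.
(* The sign (-1)^r meets the (-1)^(r+1) of the binomial sum, which leaves the leading minus. *)
have -> : (1 - b%:R) ^- r = (-1) ^+ r * (b%:R - 1) ^- r :> R.
  by rewrite -[1 - _]opprB [(- (_ - _)) ^+ _]exprNn invfM -exprVn invrN1.
rewrite exprS invfM.
have := mulVf n0; move: (_^-1) => n' nn'.
set X := (_ ^- r); set Y := (_ - 1)^-1.
transitivity (n' * (b ^ m)%:R * (- Y * ((1 - b%:R) * ((-1) ^+ r * X)) * S)).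
  by ring.
by rewrite nn' mul1r.
Qed.

End coefficients.

(** * The Walsh decomposition and the coefficient formula *)

Unset Implicit Arguments.
Set Strict Implicit.

Theorem theorem10 (R : realType) (b s m : nat)
    (d : measure_display) (Omega : measurableType d) (P : probability Omega R)
    (V : 'I_(b ^ m) -> Rvec R s) (U : 'I_(b ^ m) -> Omega -> Rvec R s)
    (I J : Omega -> 'I_(b ^ m)) (psi : Rvec R s * Rvec R s -> R) :
  prime b -> (1 <= s)%N -> (1 <= m)%N ->
  is_net V -> is_scrambling P V U ->
  is_random_pair P U I J -> is_joint_pdf P U I J psi ->
  diagonal_walsh_decomposition b psi /\
  forall l : s.-tuple nat, l != mzero_idx ->
    let n := (b ^ m)%N in
    let r := nonzero_coords l in
    let c := excess b m l in
    walsh_coef b psi l l =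
    (- (n%:R - 1)^-1 * (1 - b%:R) ^ (1 - r%:Z) *
      \sum_(0 <= i < r - c) (- b%:R) ^+ i * 'C(r.-1, i)%:R)%:C%C.
Proof.
move=> /prime_gt1 b_gt1 _ m_gt0 netV scrU IJ_pair psiP.
(* When l = j no digit vector exists; the zero vector serves as default, since such pairs have
   weight 0, and it is below m because m >= 1. *)
have ex_digits (lj : 'I_(b ^ m) * 'I_(b ^ m)) : exists i : s.-tuple nat,
    (lj.1 != lj.2 -> Dset b i (V lj.1, V lj.2)) /\ forall u, (tnth i u < m)%N.
  case: lj => l j /=; have [->|lj] := eqVneq l j.
    by exists mzero_idx; split=> [|u]; rewrite ?eqxx// tnth_mktuple.
  by have [i [iD im]] := net_common_digits b_gt1 netV lj; exists i.
have [gam gamP] := choice ex_digits.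
have gamD l j : l != j -> Dset b (gam (l, j)) (V l, V j) by exact: (gamP (l, j)).1.
have gamm lj u : (tnth (gam lj) u < m)%N by exact: (gamP lj).2.
have coefE := walsh_coef_joint_pdf b_gt1 gamD gamm scrU IJ_pair psiP.
split; last first.
  by move=> l l0; rewrite coefE eqxx (net_mixture_coef b_gt1 netV gamD).
(* The constant coefficient is the integral of psi, which is the total mass of a probability law. *)
have coef0 : mixture_coef b (@pair_weight R _) gam mzero_idx = 1.
  apply: (@complexI R); have := coefE mzero_idx mzero_idx; rewrite eqxx => <-.
  have [_ _ psi_int] := psiP.
  rewrite walsh_coef0//; congr (_%:C%C).
  have := psi_int _ measurableT; rewrite setTI => psiT.
  by rewrite /Rintegral -psiT (_ : [set w | _] = setT)// probability_setT.
split.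
- by rewrite coefE eqxx coef0.
- by move=> k l kl; rewrite coefE (negbTE kl).
have := joint_pdf_ae b_gt1 gamD gamm scrU IJ_pair psiP.
apply: filterS => z psiz cz.
have /= [->] := psiz cz.
pose term l := walsh_coef b psi l l * wal b l z.1 * conjc (wal b l z.2).
(* All digit vectors are bounded by m, so every coefficient outside this finite set vanishes. *)
pose box := [fset box_index t | t : {ffun 'I_s -> 'I_(b ^ m)}]%fset.
have term_out l : l \notin box -> term l = 0.
  move=> lbox; rewrite /term coefE eqxx.
  have [j bl] : exists j, (b ^ m <= tnth l j)%N.
    apply/existsP; apply: contraNT lbox => /existsPn h.
    have [t ->] : exists t : {ffun 'I_s -> 'I_(b ^ m)}, l = box_index t.
      by apply: box_indexP => j; rewrite ltnNge.
    exact: in_imfset.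
  by rewrite (mixture_coef_small b_gt1 _ gamm bl) rmorph0 !mul0r.
(* The constant 1 of the series is thus its missing term at index 0. *)
have term0 : term mzero_idx = 1.
  rewrite /term coefE eqxx coef0 mul1r.
  by rewrite /wal !big1 ?mul1r ?conjc1// => j _; rewrite tnth_mktuple wal1_0.
have sumE (F : {fset s.-tuple nat}) : (box `<=` F)%fset ->
    1 + \sum_(l <- F | l != mzero_idx) term l =
    (mixture b (@pair_weight R _) gam z)%:C%C.
  move=> boxF.
  have zbox : mzero_idx \in box.
    have [t ->] : exists t : {ffun 'I_s -> 'I_(b ^ m)}, mzero_idx = box_index t.
      by apply: box_indexP => j; rewrite tnth_mktuple expn_gt0 (ltnW b_gt1).
    exact: in_imfset.
  rewrite -term0 -bigD1_seq ?fset_uniq//; last exact: (fsubsetP boxF).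
  rewrite -(big_fset_incl _ boxF); last by move=> l _; exact: term_out.
  rewrite big_imfset/=; last by move=> t u _ _; exact: box_index_inj.
  rewrite (mixture_expansion b_gt1 _ gamm)// big_enum/=.
  by apply: eq_bigr => t _; rewrite /term coefE eqxx mulrA.
have tot_filter := @summability.totally_filter (s.-tuple nat).
(* The partial sums are constant from [box] on. *)
apply: cvg_near_cst; exists box => // F boxF; exact: sumE.
Qed.
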